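(* Let $\{x_{ij};\, i,j\ge 1\}$ be i.i.d. real random variables with mean $\mu$ and variance $\sigma^2>0$, and suppose $E e^{t_0|x_{11}|^{\alpha}}<\infty$ for some $\alpha>0$ and $t_0>0$. Set $\beta=\alpha/(4+\alpha)$. Let $p=p(n)$ be positive integers with $p\to\infty$ and $\log p=o(n^{\beta})$ as $n\to\infty$. Let $X_n=(x_{ij})_{1\le i\le n,\,1\le j\le p}$ and let $L_n$ be the coherence of $X_n$, i.e. the largest absolute value of the off-diagonal entries of its sample correlation matrix. Then $$\sqrt{\frac{n}{\log p}}\;L_n\to 2\quad\text{in probability as } n\to\infty .$$
   Context: Let $x_1,\dots,x_p\in\mathbb{R}^n$ be the columns of $X_n$, $\bar x_k=\frac1n\sum_{i=1}^n x_{ik}$, and $e=(1,\dots,1)^T\in\mathbb{R}^n$; write $x_i-\bar x_i$ for $x_i-\bar x_i e$. With $\|\cdot\|$ the Euclidean norm, the sample correlation coefficients are $$\rho_{ij}=\frac{(x_i-\bar x_i)^T(x_j-\bar x_j)}{\|x_i-\bar x_i\|\cdot\|x_j-\bar x_j\|},\quad 1\le i,j\le p,$$ and $L_n=\max_{1\le i<j\le p}|\rho_{ij}|$. $\log$ is the natural logarithm. *)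

(* Defs.v *)
From HB Require Import structures.
From mathcomp Require Import all_boot all_order all_algebra finmap.
From mathcomp Require Import all_classical all_reals all_analysis.

Set Implicit Arguments.
Unset Strict Implicit.
Unset Printing Implicit Defensive.

Import Order.TTheory GRing.Theory Num.Theory.
Import numFieldNormedType.Exports.

Local Open Scope classical_set_scope.
Local Open Scope ring_scope.

Section sample_correlation.
Context {R : rcfType} {n p : nat}.
Implicit Type X : 'M[R]_(n, p).

(* The library norm on matrices is the sup norm. *)
Definition euclidean_norm (v : 'cV[R]_n) : R :=
  Num.sqrt (\sum_(i < n) v i 0 ^+ 2).

Definition column_mean X (k : 'I_p) : R := n%:R^-1 * \sum_(i < n) X i k.

Definition centered_column X (k : 'I_p) : 'cV[R]_n :=
  col k X - const_mx (column_mean X k).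

(* When a column is constant its correlations are 0 / 0 on paper; division by 0
   makes them 0 here. *)
Definition sample_correlation X : 'M[R]_p :=
  \matrix_(i, j)
    (((centered_column X i)^T *m centered_column X j) 0 0 /
     (euclidean_norm (centered_column X i) *
      euclidean_norm (centered_column X j))).

(* The maximum over the empty set of pairs (p <= 1) is 0. *)
Definition coherence X : R :=
  \big[Num.max/0]_(ij : 'I_p * 'I_p | (ij.1 < ij.2)%N)
    `|sample_correlation X ij.1 ij.2|.

End sample_correlation.

Section random_families.
Context {d : measure_display} {T : measurableType d} {R : realType}.
Variable P : probability T R.

Definition mutually_independent (I : choiceType) (X : I -> {RV P >-> R}) :=
  forall (J : {fset I}) (B : I -> set R), (forall i, measurable (B i)) ->
    P (\bigcap_(i in [set` J]) (X i @^-1` B i)) =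
    (\prod_(i <- J) P (X i @^-1` B i))%E.

Definition identically_distributed (I : Type) (X : I -> {RV P >-> R}) :=
  forall (i j : I) (B : set R), measurable B ->
    distribution P (X i) B = distribution P (X j) B.

Definition iid (I : choiceType) (X : I -> {RV P >-> R}) :=
  mutually_independent X /\ identically_distributed X.

Definition cvg_in_probability (Y : nat -> T -> R) (Z : T -> R) :=
  forall eps : R, 0 < eps ->
    P [set w | eps < `|Y n w - Z w|] @[n --> \oo] --> 0%E.

(* Indices start at 0. *)
Definition data_matrix (x : nat -> nat -> {RV P >-> R}) (n p : nat) (w : T)
    : 'M[R]_(n, p) :=
  \matrix_(i < n, j < p) x i j w.

End random_families.

(* Main.v *)
(** The correlations are invariant under affine maps, so assume mean 0 and
   variance 1; write l = log p and th = (l / n)^(1/2).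

   Truncating the entries at level B with B^2 th = ka, a small constant, costs
   nothing: B^al >> n^be >> log n + log p, so with probability tending to 1 no
   entry exceeds B.  Rounding the truncated entries to a finite grid replaces the
   probability space by a finite product, on which all expectations are finite
   sums.  For bounded z of variance close to 1 the moment generating function at
   x th is exp (x^2 th^2 / 2) up to a factor exp (O(ka) th^2), and everything
   follows from this:
   - Chernoff bounds control column sums, column norms, and, by a union bound over
     the p^2 pairs, the inner products from above by (2 + eps) (n l)^(1/2);
   - a tilting argument bounds the probability a that the inner product of two
     columns exceeds (2 - eps) (n l)^(1/2) from below by p^(-2 + eps);
   - if both inner products of one column with two others exceed this threshold,
     so does, at twice the level, the inner product with their sum; hence that
     event has probability b at most p^(-4 + 4 eps), and the second moment method
     applied to the pairs (i, j) in a product J x K shows that some pair exceeds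
     the threshold, since b << p a^2. *)

Require Import Defs.
From HB Require Import structures.
From mathcomp Require Import all_boot all_order all_algebra finmap.
From mathcomp Require Import all_classical all_reals all_analysis.
From mathcomp Require Import measurable_realfun zify ring lra.

Set Implicit Arguments.
Unset Strict Implicit.
Unset Printing Implicit Defensive.

Import Order.TTheory GRing.Theory Num.Theory.
Import numFieldNormedType.Exports.

Local Open Scope ring_scope.

(** * Exponential bounds and finite expectations *)

Section exp_bounds.
Local Open Scope classical_set_scope.
Local Open Scope ring_scope.
Context {R : realType}.
Implicit Types u c : R.

(** A Taylor polynomial with a free cubic term, divided by the exponential. The derivative factors
    with a single sign change besides the double zero at 0. Since [g c 0 = 1], monotonicity for c =
    0 and for c = 1/2 gives bounds on [expR] from both sides, with the roles of the two constants
    swapping at 0. *)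
Let g c (u : R) : R := expR (- u) * (1 + u + u ^+ 2 / 2 + c * u ^+ 3).

Let g0 c : g c 0 = 1.
Proof. rewrite /g oppr0 expR0; ring. Qed.

Let is_derive_g c u :
  is_derive u 1 (g c) (expR (- u) * u ^+ 2 * (3 * c - 2^-1 - c * u)).
Proof.
rewrite /g; apply: is_derive_eq.
by rewrite /GRing.scale /=; field.
Qed.

Let derivable_g c u : derivable (g c) u 1.
Proof. by case: (is_derive_g c u). Qed.

Let derive1_g c u : derive1 (g c) u = expR (- u) * u ^+ 2 * (3 * c - 2^-1 - c * u).
Proof. by rewrite derive1E; case: (is_derive_g c u). Qed.

Let continuous_g c : continuous (g c).
Proof. by move=> u; apply/differentiable_continuous/derivable1_diffP. Qed.

Let continuous_g_within c (A : set R) : {within A, continuous (g c)}.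
Proof. exact/continuous_subspaceT/continuous_g. Qed.

Let g0_nincr u v : u <= v -> g 0 v <= g 0 u.
Proof.
move=> uv; apply: (@ler0_derive1_nincrNy _ (g 0) v) => // z _.
rewrite derive1_g mulr0 mul0r subr0 sub0r mulrN oppr_le0.
by rewrite divr_ge0// mulr_ge0 ?expR_ge0 ?sqr_ge0.
Qed.

Let gh_ndecr u v : u <= v -> v <= 1 -> g 2^-1 u <= g 2^-1 v.
Proof.
move=> uv v1; apply: (@ger0_derive1_ndecrNy _ (g 2^-1) v) => // z.
rewrite in_itv /= => zv; rewrite derive1_g.
by apply: mulr_ge0; [rewrite mulr_ge0 ?expR_ge0 ?sqr_ge0 | lra].
Qed.

Let expR_le_poly c u : 1 <= g c u -> expR u <= 1 + u + u ^+ 2 / 2 + c * u ^+ 3.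
Proof.
move=> h; rewrite -[leLHS]mulr1; apply: le_trans (ler_wpM2l (expR_ge0 u) h) _.
by rewrite /g [expR u * (_ * _)]mulrA expRxMexpNx_1 mul1r.
Qed.

Let expR_ge_poly c u : g c u <= 1 -> 1 + u + u ^+ 2 / 2 + c * u ^+ 3 <= expR u.
Proof.
move=> h; rewrite -[leRHS]mulr1; apply: le_trans (ler_wpM2l (expR_ge0 u) h).
by rewrite /g [expR u * (_ * _)]mulrA expRxMexpNx_1 mul1r.
Qed.

(** For u >= 0 the cubic term u^3 / 2 is exactly the relative error |u| of the quadratic term; for u
    < 0 the quadratic polynomial is already an upper bound. *)
Lemma expR_le_quadratic u : `|u| <= 1 ->
  expR u <= 1 + u + u ^+ 2 / 2 * (1 + `|u|).
Proof.
rewrite ler_norml => /andP[_ u1]; have [u0|u0] := leP 0 u.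
  have := gh_ndecr u0 u1; rewrite g0 => /expR_le_poly h.
  by apply: le_trans h _; rewrite ger0_norm//; lra.
have := g0_nincr (ltW u0); rewrite g0 => /expR_le_poly h.
have := mulr_ge0 (sqr_ge0 u) (normr_ge0 u).
by lra.
Qed.

Lemma expR_ge_quadratic u : `|u| <= 1 ->
  1 + u + u ^+ 2 / 2 * (1 - `|u|) <= expR u.
Proof.
rewrite ler_norml => /andP[_ u1]; have [u0|u0] := leP 0 u.
  have := g0_nincr u0; rewrite g0 => /expR_ge_poly h.
  have := mulr_ge0 (sqr_ge0 u) (normr_ge0 u).
  by lra.
have := gh_ndecr (ltW u0) ler01; rewrite g0 => /expR_ge_poly h.
by apply: le_trans h; rewrite ltr0_norm//; lra.
Qed.

(** Invert exp (- v) >= 1 - v at v = u / (1 + u). This turns a lower bound of the form 1 + u into an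
    exponential one, losing only u^2 in the exponent. *)
Lemma expR_frac_le u : 0 <= u -> expR (u / (1 + u)) <= 1 + u.
Proof.
move=> u0; have u1 : 0 < 1 + u by lra.
rewrite -[leRHS]invrK -[u / _]opprK expRN lef_pV2 ?posrE ?invr_gt0 ?expR_gt0//.
have := expR_ge1Dx (- (u / (1 + u))).
by apply: le_trans; rewrite le_eqVlt; apply/orP; left; apply/eqP; field; lra.
Qed.

End exp_bounds.

(** * Expectations on finite probability spaces and their powers *)

Section finite_expectation.
Context {R : realType}.

Definition is_pmf (A : finType) (w : A -> R) :=
  (forall a, 0 <= w a) /\ \sum_a w a = 1.

Definition Ex (A : finType) (w f : A -> R) : R := \sum_a w a * f a.

Definition Pr (A : finType) (w : A -> R) (Q : pred A) : R :=
  Ex w (fun a => (Q a)%:R).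

Definition prod_pmf (A B : finType) (w : A -> R) (w' : B -> R) (ab : A * B) : R :=
  w ab.1 * w' ab.2.

Definition pow_pmf (I A : finType) (w : A -> R) (c : {ffun I -> A}) : R :=
  \prod_i w (c i).

Definition update (I A : finType) (c : {ffun I -> A}) (i : I) (a : A) :=
  [ffun j => if j == i then a else c j].

Section basic.
Variables (A : finType) (w : A -> R).
Implicit Types (f g : A -> R) (Q : pred A).

Lemma eq_Ex f g : f =1 g -> Ex w f = Ex w g.
Proof. by move=> fg; apply: eq_bigr => a _; rewrite fg. Qed.

Lemma ExD f g : Ex w (fun a => f a + g a) = Ex w f + Ex w g.
Proof. by rewrite -big_split; apply: eq_bigr => a _; rewrite mulrDr. Qed.

Lemma ExZ k f : Ex w (fun a => k * f a) = k * Ex w f.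
Proof. by rewrite /Ex mulr_sumr; apply: eq_bigr => a _; rewrite mulrCA. Qed.

Lemma ExZr k f : Ex w (fun a => f a * k) = Ex w f * k.
Proof. by rewrite /Ex mulr_suml; apply: eq_bigr => a _; rewrite mulrA. Qed.

Lemma Ex_sum (I : finType) (S : pred I) (f : I -> A -> R) :
  Ex w (fun a => \sum_(i | S i) f i a) = \sum_(i | S i) Ex w (f i).
Proof.
by rewrite /Ex exchange_big; apply: eq_bigr => a _; rewrite mulr_sumr.
Qed.

Hypothesis w_pmf : is_pmf w.

Lemma Ex_cst k : Ex w (fun=> k) = k.
Proof. by rewrite /Ex -mulr_suml (proj2 w_pmf) mul1r. Qed.

Lemma le_Ex f g : (forall a, f a <= g a) -> Ex w f <= Ex w g.
Proof.
by move=> fg; apply: ler_sum => a _; rewrite ler_wpM2l// (proj1 w_pmf).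
Qed.

Lemma Ex_ge0 f : (forall a, 0 <= f a) -> 0 <= Ex w f.
Proof.
by move=> f0; apply: sumr_ge0 => a _; rewrite mulr_ge0// (proj1 w_pmf).
Qed.

Lemma Pr_ge0 Q : 0 <= Pr w Q.
Proof. exact: Ex_ge0. Qed.

Lemma le_Pr Q Q' : (forall a, Q a -> Q' a) -> Pr w Q <= Pr w Q'.
Proof.
by move=> QQ'; apply: le_Ex => a; rewrite ler_nat; case: (Q a) (QQ' a) => // ->.
Qed.

Lemma Pr_exists_le (I : finType) (S : pred I) (Q : I -> pred A) :
  Pr w (fun a => [exists i, S i && Q i a]) <= \sum_(i | S i) Pr w (Q i).
Proof.
rewrite -Ex_sum; apply: le_Ex => a; case: existsP => [[i /andP[Si Qi]]|_].
  by rewrite (bigD1 i)//= Qi lerDl sumr_ge0.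
by rewrite sumr_ge0.
Qed.

Lemma Pr_or_le Q Q' : Pr w (fun a => Q a || Q' a) <= Pr w Q + Pr w Q'.
Proof.
rewrite -ExD; apply: le_Ex => a.
by case: (Q a) (Q' a) => [] []; rewrite -natrD ler_nat.
Qed.

Lemma Pr_gt_chernoff (X : A -> R) (t lam : R) : 0 <= lam ->
  Pr w (fun a => t < X a) <= expR (- (lam * t)) * Ex w (fun a => expR (lam * X a)).
Proof.
move=> lam0; rewrite -ExZ; apply: le_Ex => a; rewrite -expRD.
case: ltP => tX; last exact: expR_ge0.
by rewrite -[leLHS](expR0) ler_expR addrC subr_ge0 ler_wpM2l// ltW.
Qed.

Section mgf.
Variables (W : A -> R) (M lam dlt : R).
Hypotheses (W_bound : forall a, `|W a| <= M).
Hypotheses (lamM : `|lam| * M <= dlt) (dlt1 : dlt <= 1).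

Let lamW a : `|lam * W a| <= dlt.
Proof. by rewrite normrM; apply: le_trans lamM; rewrite ler_wpM2l. Qed.

Lemma mgf_le : Ex w (fun a => expR (lam * W a)) <=
  expR (lam * Ex w W + lam ^+ 2 / 2 * (1 + dlt) * Ex w (fun a => W a ^+ 2)).
Proof.
apply: le_trans (expR_ge1Dx _); rewrite -[X in _ <= X + _](Ex_cst 1) -!ExZ -!ExD.
apply: le_Ex => a; apply: le_trans (expR_le_quadratic _) _.
  exact: le_trans (lamW a) dlt1.
have := ler_wpM2l (sqr_ge0 (lam * W a)) (lamW a).
by lra.
Qed.

(** The bound stays in the form 1 + u, because 1 + u <= exp u points the wrong way here;
    [expR_frac_le] exponentiates it once u is known to be small. *)
Lemma mgf_ge :
  1 + (lam * Ex w W + lam ^+ 2 / 2 * (1 - dlt) * Ex w (fun a => W a ^+ 2)) <=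
  Ex w (fun a => expR (lam * W a)).
Proof.
rewrite -[X in X + _](Ex_cst 1) -!ExZ -!ExD.
apply: le_Ex => a; apply: le_trans (expR_ge_quadratic _); last first.
  exact: le_trans (lamW a) dlt1.
have := ler_wpM2l (sqr_ge0 (lam * W a)) (lamW a).
by lra.
Qed.

End mgf.
End basic.

Lemma prod_pmfP (A B : finType) (w : A -> R) (w' : B -> R) :
  is_pmf w -> is_pmf w' -> is_pmf (prod_pmf w w').
Proof.
move=> [w0 w1] [w'0 w'1]; split=> [ab|]; first by rewrite mulr_ge0.
rewrite -(pair_bigA _ (fun a b => w a * w' b))/= -[RHS]w1.
by apply: eq_bigr => a _; rewrite -mulr_sumr w'1 mulr1.
Qed.

Lemma Ex_prod (A B : finType) (w : A -> R) (w' : B -> R) (f : A * B -> R) :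
  Ex (prod_pmf w w') f = Ex w (fun a => Ex w' (fun b => f (a, b))).
Proof.
transitivity (\sum_p prod_pmf w w' (p.1, p.2) * f (p.1, p.2)).
  by apply: eq_bigr => -[].
rewrite -(pair_bigA _ (fun a b => prod_pmf w w' (a, b) * f (a, b)))/=.
by apply: eq_bigr => a _; rewrite mulr_sumr; apply: eq_bigr => b _; rewrite mulrA.
Qed.

Lemma exchange_Ex (A B : finType) (w : A -> R) (w' : B -> R) (f : A -> B -> R) :
  Ex w (fun a => Ex w' (f a)) = Ex w' (fun b => Ex w (f^~ b)).
Proof.
rewrite /Ex; under eq_bigr => a _ do rewrite mulr_sumr.
rewrite exchange_big/=; apply: eq_bigr => b _; rewrite mulr_sumr.
by apply: eq_bigr => a _; rewrite mulrCA.
Qed.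

Section power.
Variables (I A : finType) (w : A -> R).

Lemma Ex_pow_prod (f : I -> A -> R) :
  Ex (pow_pmf (I := I) w) (fun c => \prod_i f i (c i)) = \prod_i Ex w (f i).
Proof.
rewrite /Ex bigA_distr_bigA; apply: eq_bigr => c _.
by rewrite -big_split.
Qed.

Hypothesis w_pmf : is_pmf w.

Lemma pow_pmfP : is_pmf (pow_pmf (I := I) w).
Proof.
split=> [c|]; first by apply: prodr_ge0 => i _; rewrite (proj1 w_pmf).
rewrite /pow_pmf -(bigA_distr_bigA (fun=> w)) big1// => i _.
exact: (proj2 w_pmf).
Qed.

(** Two independent columns are read row by row. The exponential of an inner product is such a
    product over rows, so its expectation is the n-th power of a one-row expectation. *)
Lemma Ex_pow2_prod (f : I -> A -> A -> R) :
  Ex (prod_pmf (pow_pmf (I := I) w) (pow_pmf w))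
    (fun c => \prod_i f i (c.1 i) (c.2 i)) =
  \prod_i Ex (prod_pmf w w) (fun a => f i a.1 a.2).
Proof.
rewrite Ex_prod /=.
under eq_Ex => c do rewrite (Ex_pow_prod (fun i => f i (c i))).
rewrite (Ex_pow_prod (fun i a => Ex w (f i a))).
by apply: eq_bigr => i _; rewrite Ex_prod.
Qed.

Lemma Ex_pow3_prod (f : I -> A -> A -> A -> R) :
  Ex (prod_pmf (pow_pmf (I := I) w) (prod_pmf (pow_pmf w) (pow_pmf w)))
    (fun c => \prod_i f i (c.1 i) (c.2.1 i) (c.2.2 i)) =
  \prod_i Ex (prod_pmf w (prod_pmf w w)) (fun a => f i a.1 a.2.1 a.2.2).
Proof.
rewrite Ex_prod /=.
under eq_Ex => c do rewrite (Ex_pow2_prod (fun i => f i (c i))).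
rewrite (Ex_pow_prod (fun i a => Ex (prod_pmf w w) (fun b => f i a b.1 b.2))).
by apply: eq_bigr => i _; rewrite Ex_prod.
Qed.

(* The map (c, a) |-> (c[i := a], c i) is an involution that preserves the
   product weights. *)
Lemma Ex_pow_update (i : I) (f : {ffun I -> A} -> R) :
  Ex (pow_pmf w) f = Ex (pow_pmf w) (fun c => Ex w (fun a => f (update c i a))).
Proof.
pose h (ca : {ffun I -> A} * A) := (update ca.1 i ca.2, ca.1 i).
have hK : involutive h.
  move=> [c a]; rewrite /h/=; congr pair; last by rewrite ffunE eqxx.
  by apply/ffunP => j; rewrite !ffunE; case: eqP => [->|//].
have := Ex_prod (pow_pmf w) w (fun ca => f (update ca.1 i ca.2)) => /= <-.
have := Ex_prod (pow_pmf w) w (fun ca => f ca.1) => /=.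
under [RHS]eq_Ex => c do rewrite (Ex_cst w_pmf).
move=> <-; rewrite /Ex (reindex_inj (inv_inj hK)); apply: eq_bigr => -[c a] _.
congr (_ * _); rewrite /prod_pmf /pow_pmf /=.
rewrite (bigD1 i)//= [in RHS](bigD1 i)//= ffunE eqxx.
under eq_bigr => j ji do rewrite ffunE (negbTE ji).
by ring.
Qed.

End power.

End finite_expectation.

(** * Marginals of product weights and the second moment method *)

Section marginals.
Context {R : realType}.
Variables (I A : finType) (w : A -> R).
Hypothesis w_pmf : is_pmf w.

Lemma update_same (c : {ffun I -> A}) i a : update c i a i = a.
Proof. by rewrite ffunE eqxx. Qed.

Lemma update_other (c : {ffun I -> A}) i j a : j != i -> update c i a j = c j.
Proof. by move=> ji; rewrite ffunE (negbTE ji). Qed.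

(** Redrawing coordinate i makes it an independent outer variable. The marginal lemmas below peel
    off one coordinate at a time this way. *)
Lemma Ex_pow_resample i (f : {ffun I -> A} -> R) (g : A -> {ffun I -> A} -> R) :
  (forall c a, f (update c i a) = g a c) ->
  Ex (pow_pmf (I := I) w) f = Ex w (fun a => Ex (pow_pmf (I := I) w) (g a)).
Proof.
move=> fg; rewrite (Ex_pow_update w_pmf i) -exchange_Ex; apply: eq_Ex => c.
exact: eq_Ex.
Qed.

Lemma Ex_marginal1 i (f : A -> R) : Ex (pow_pmf (I := I) w) (fun c => f (c i)) = Ex w f.
Proof.
rewrite (Ex_pow_resample (i := i) (g := fun a _ => f a)) => [|c a].
  by apply: eq_Ex => a; exact/Ex_cst/pow_pmfP.
by rewrite update_same.
Qed.

Lemma Ex_marginal2 i j (f : A -> A -> R) : i != j ->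
  Ex (pow_pmf (I := I) w) (fun c => f (c i) (c j)) = Ex w (fun a => Ex w (f a)).
Proof.
move=> ij; rewrite (Ex_pow_resample (i := i) (g := fun a c => f a (c j))).
  by apply: eq_Ex => a; rewrite Ex_marginal1.
by move=> c a; rewrite update_same update_other// eq_sym.
Qed.

Lemma Ex_marginal3 i j k (f : A -> A -> A -> R) : uniq [:: i; j; k] ->
  Ex (pow_pmf (I := I) w) (fun c => f (c i) (c j) (c k)) =
  Ex w (fun a => Ex w (fun b => Ex w (f a b))).
Proof.
rewrite /= !inE !negb_or => /and3P[/andP[ij ik] jk _].
rewrite (Ex_pow_resample (i := i) (g := fun a c => f a (c j) (c k))).
  by apply: eq_Ex => a; rewrite Ex_marginal2.
by move=> c a; rewrite update_same !update_other// eq_sym.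
Qed.

Lemma Ex_marginal4 i j k l (f : A -> A -> A -> A -> R) : uniq [:: i; j; k; l] ->
  Ex (pow_pmf (I := I) w) (fun c => f (c i) (c j) (c k) (c l)) =
  Ex w (fun a => Ex w (fun b => Ex w (fun c => Ex w (f a b c)))).
Proof.
rewrite cons_uniq !inE !negb_or => /andP[/and3P[ij ik il] jkl].
rewrite (Ex_pow_resample (i := i) (g := fun a c => f a (c j) (c k) (c l))).
  by apply: eq_Ex => a; rewrite Ex_marginal3.
by move=> c a; rewrite update_same !update_other// eq_sym.
Qed.

Section second_moment.
Variables (Q : A -> A -> bool) (J K : {set I}) (m : nat).
Hypotheses (Q_sym : forall a b, Q a b = Q b a) (JK : [disjoint J & K]).
Hypotheses (m_gt0 : (0 < m)%N) (cardJ : #|J| = m) (cardK : #|K| = m).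

Let al : R := Pr (prod_pmf w w) (fun a => Q a.1 a.2).
Let bt : R :=
  Pr (prod_pmf w (prod_pmf w w)) (fun a => Q a.1 a.2.1 && Q a.1 a.2.2).

Let al_ge0 : 0 <= al. Proof. exact/Pr_ge0/prod_pmfP. Qed.

Let bt_ge0 : 0 <= bt. Proof. exact/Pr_ge0/prod_pmfP/prod_pmfP. Qed.

Let QQ (i j i' j' : I) : R := Ex (pow_pmf (I := I) w)
  (fun v => (Q (v i) (v j))%:R * (Q (v i') (v j'))%:R).

Let JK_neq i j : i \in J -> j \in K -> i != j.
Proof.
move=> iJ jK; apply/eqP => ij; move/pred0P: JK => /(_ i) /=.
by rewrite iJ ij jK.
Qed.

(** Disjointness of J and K leaves four cases: equal pairs give [al], pairs sharing one index form a
    star and give [bt] (by symmetry of Q also when the centre lies in K), and pairs without a common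
    index are independent. The indicators put the cases into one summable expression. *)
Let QQ_le i j i' j' : i \in J -> j \in K -> i' \in J -> j' \in K ->
  QQ i j i' j' <= al ^+ 2 + (i == i')%:R * bt + (j == j')%:R * bt
                  + (i == i')%:R * (j == j')%:R * al.
Proof.
move=> iJ jK i'J j'K.
have ij := JK_neq iJ jK; have i'j' := JK_neq i'J j'K.
have ij' := JK_neq iJ j'K; have i'j := JK_neq i'J jK.
have al2 : 0 <= al ^+ 2 by exact: sqr_ge0.
have al0 : 0 <= al := al_ge0; have bt0 : 0 <= bt := bt_ge0.
have [ii'|ii'] := eqVneq i i'; have [jj'|jj'] := eqVneq j j'.
- suff -> : QQ i j i' j' = al by rewrite !mul1r; lra.
  rewrite /QQ -ii' -jj'.
  under eq_Ex do rewrite -natrM mulnb andbb.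
  by rewrite (Ex_marginal2 (fun a b => (Q a b)%:R))// /al /Pr Ex_prod.
- suff -> : QQ i j i' j' = bt by rewrite !mul1r !mul0r; lra.
  rewrite /QQ -ii'; under eq_Ex do rewrite -natrM mulnb.
  rewrite (Ex_marginal3 (fun a b c => (Q a b && Q a c)%:R)).
    by rewrite /bt /Pr Ex_prod; apply: eq_Ex => a; rewrite Ex_prod.
  by rewrite /= !inE !negb_or ij ij' jj'.
- suff -> : QQ i j i' j' = bt by rewrite !mul1r !mul0r; lra.
  rewrite /QQ -jj'; under eq_Ex do rewrite -natrM mulnb Q_sym [Q _ (_ j)]Q_sym.
  rewrite (Ex_marginal3 (i := j) (j := i) (k := i') (fun a b c => (Q a b && Q a c)%:R)).
    by rewrite /bt /Pr Ex_prod; apply: eq_Ex => a; rewrite Ex_prod.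
  by rewrite /= !inE !negb_or eq_sym ij eq_sym i'j ii'.
- suff -> : QQ i j i' j' = al ^+ 2 by rewrite !mul0r; lra.
  rewrite /QQ (Ex_marginal4 (fun a b c d => (Q a b)%:R * (Q c d)%:R)).
    under eq_Ex => a do under eq_Ex => b do
      (under eq_Ex => c do rewrite ExZ); rewrite ?ExZ.
    under eq_Ex => a do under eq_Ex => b do rewrite ExZ.
    under eq_Ex => a do rewrite ExZr.
    by rewrite ExZr expr2 /al /Pr !Ex_prod.
  by rewrite /= !inE !negb_or ij ii' ij' (eq_sym j) i'j jj' i'j'.
Qed.

(* For pairs in a product [J x K] of disjoint sets, only pairs sharing an index are
   correlated. *)
Lemma second_moment_bound : 0 < al ->
  Pr (pow_pmf (I := I) w)
    (fun v => [forall i in J, forall j in K, ~~ Q (v i) (v j)]) <=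
  2 * bt / (m%:R * al ^+ 2) + (m%:R ^+ 2 * al)^-1.
Proof.
move=> al0; have m0 : (0 : R) < m%:R by rewrite ltr0n.
pose N (v : {ffun I -> A}) : R :=
  \sum_(i in J) \sum_(j in K) (Q (v i) (v j))%:R.
pose M := m%:R ^+ 2 * al.
have M0 : 0 < M by rewrite /M mulr_gt0// exprn_gt0.
have sumc (L : {set I}) (x : R) : #|L| = m -> \sum_(k in L) x = m%:R * x.
  by move=> Lm; rewrite sumr_const Lm mulr_natl.
have EN : Ex (pow_pmf (I := I) w) N = M.
  rewrite /N Ex_sum; under eq_bigr => i iJ.
    rewrite Ex_sum; under eq_bigr => j jK do
      rewrite (Ex_marginal2 (fun a b => (Q a b)%:R)) ?JK_neq//.
    rewrite sumc//; over.
  by rewrite sumc// mulrA -expr2 /M /al /Pr Ex_prod.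
have EN2 : Ex (pow_pmf (I := I) w) (fun v => N v ^+ 2) <=
    M ^+ 2 + 2 * m%:R ^+ 3 * bt + m%:R ^+ 2 * al.
  have -> : Ex (pow_pmf (I := I) w) (fun v => N v ^+ 2) =
      \sum_(i in J) \sum_(j in K) \sum_(i' in J) \sum_(j' in K) QQ i j i' j'.
    rewrite /QQ; under [RHS]eq_bigr => i _ do under eq_bigr => j _ do
      under eq_bigr => i' _ do rewrite -Ex_sum.
    under [RHS]eq_bigr => i _ do under eq_bigr => j _ do rewrite -Ex_sum.
    under [RHS]eq_bigr => i _ do rewrite -Ex_sum.
    rewrite -Ex_sum; apply: eq_Ex => v; rewrite expr2 {1}/N mulr_suml.
    apply: eq_bigr => i _; rewrite mulr_suml; apply: eq_bigr => j _.
    rewrite mulr_sumr; apply: eq_bigr => i' _.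
    by rewrite mulr_sumr.
  apply: (@le_trans _ _ (\sum_(i in J) \sum_(j in K) \sum_(i' in J) \sum_(j' in K)
      (al ^+ 2 + (i == i')%:R * bt + (j == j')%:R * bt
                  + (i == i')%:R * (j == j')%:R * al))).
    apply: ler_sum => i iJ; apply: ler_sum => j jK.
    by apply: ler_sum => i' i'J; apply: ler_sum => j' j'K; exact: QQ_le.
  have sum_eq (L : {set I}) (k : I) (x : R) : k \in L ->
      \sum_(k' in L) (k == k')%:R * x = x.
    move=> kL; rewrite (bigD1 k)//= eqxx mul1r big1 ?addr0// => k' /andP[_ kk'].
    by rewrite eq_sym (negbTE kk') mul0r.
  (* For fixed (i, j) the four terms are counted m^2, m, m and 1 times. *)
  have -> : \sum_(i in J) \sum_(j in K) \sum_(i' in J) \sum_(j' in K)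
      (al ^+ 2 + (i == i')%:R * bt + (j == j')%:R * bt
                  + (i == i')%:R * (j == j')%:R * al) =
      \sum_(i in J) \sum_(j in K) (m%:R ^+ 2 * al ^+ 2 + m%:R * bt + m%:R * bt + al).
    apply: eq_bigr => i iJ; apply: eq_bigr => j jK.
    under eq_bigr => i' i'J.
      rewrite !big_split/= !sumc// sum_eq//.
      under [X in _ + X]eq_bigr do rewrite -mulrA mulrCA.
      rewrite sum_eq//; over.
    rewrite !big_split/= !sumc// -mulr_sumr !sum_eq//; ring.
  rewrite !sumc// /M le_eqVlt.
  apply/orP; left.
  by apply/eqP; ring.
have -> : 2 * bt / (m%:R * al ^+ 2) + (m%:R ^+ 2 * al)^-1 =
    M ^- 2 * (M ^+ 2 + 2 * m%:R ^+ 3 * bt + m%:R ^+ 2 * al - 2 * M * M + M ^+ 2).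
  by rewrite /M; field; rewrite ?gt_eqF.
(* Chebyshev's inequality: if no pair is related, then N = 0 and (N - M)^2 / M^2 = 1. *)
apply: (@le_trans _ _ (M ^- 2 * Ex (pow_pmf (I := I) w) (fun v => (N v - M) ^+ 2))).
  rewrite -ExZ; apply: le_Ex; first exact: pow_pmfP.
  move=> v; case: (boolP [forall i in J, _]) => [/forall_inP h|_]; last first.
    by rewrite mulr_ge0 ?sqr_ge0// invr_ge0 sqr_ge0.
  have -> : N v = 0.
    apply: big1 => i iJ; apply: big1 => j jK.
    by have /forall_inP /(_ j jK) /negbTE -> := h i iJ.
  by rewrite sub0r sqrrN mulVf// expf_neq0// gt_eqF.
apply: ler_wpM2l; first by rewrite invr_ge0 sqr_ge0.
have -> : Ex (pow_pmf (I := I) w) (fun v => (N v - M) ^+ 2) =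
    Ex (pow_pmf (I := I) w) (fun v => N v ^+ 2) + (- 2 * M) * Ex (pow_pmf (I := I) w) N + M ^+ 2.
  rewrite -[X in _ + X](Ex_cst (pow_pmfP I w_pmf)) -ExZ -!ExD.
  by apply: eq_Ex => v; ring.
by rewrite EN; move: EN2; lra.
Qed.

End second_moment.
End marginals.

(* Exponential tilting without a change of measure: under the weight [e^((r+a)Y)]
   the mass sits in the window [r l < Y <= (r + 2 a) l], because its two
   complements are killed by the exponential moments at [r] and [r + 2 a]. *)
Lemma Pr_gt_tilting {R : realType} (A : finType) (w Y : A -> R) (l r a k : R) :
  is_pmf w -> 0 <= r -> 0 <= a ->
  expR (l * ((r + a) ^+ 2 / 2 - k)) <= Ex w (fun x => expR ((r + a) * Y x)) ->
  Ex w (fun x => expR (r * Y x)) <= expR (l * (r ^+ 2 / 2 + k)) ->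
  Ex w (fun x => expR ((r + 2 * a) * Y x)) <= expR (l * ((r + 2 * a) ^+ 2 / 2 + k)) ->
  4 <= expR (l * (a ^+ 2 / 2 - 2 * k)) ->
  2^-1 * expR (- (l * ((r + a) * (r + 3 * a) / 2 + k))) <=
    Pr w (fun x => r * l < Y x).
Proof.
move=> w_pmf r0 a0 hlow hr hr2 h4.
pose e1 := expR ((r + a) * (r + 2 * a) * l).
pose e2 := expR (a * r * l); pose e3 := expR (- (a * (r + 2 * a) * l)).
have split_le : Ex w (fun x => expR ((r + a) * Y x)) <=
    e1 * Pr w (fun x => r * l < Y x) + e2 * Ex w (fun x => expR (r * Y x))
    + e3 * Ex w (fun x => expR ((r + 2 * a) * Y x)).
  rewrite -!ExZ -!ExD; apply: le_Ex => // x; rewrite /e1 /e2 /e3 -!expRD.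
  have p1 := expR_ge0 (a * r * l + r * Y x).
  have p2 := expR_ge0 (- (a * (r + 2 * a) * l) + (r + 2 * a) * Y x).
  have p3 := expR_ge0 ((r + a) * (r + 2 * a) * l).
  have [Yr|Yr] := leP (Y x) (r * l); rewrite ?mulr0 ?mulr1.
    suff : expR ((r + a) * Y x) <= expR (a * r * l + r * Y x) by lra.
    by rewrite ler_expR; have := ler_wpM2l a0 Yr; lra.
  have [Yr2|Yr2] := leP (Y x) ((r + 2 * a) * l).
    suff : expR ((r + a) * Y x) <= expR ((r + a) * (r + 2 * a) * l) by lra.
    by rewrite ler_expR -mulrA ler_wpM2l// addr_ge0.
  suff : expR ((r + a) * Y x) <=
    expR (- (a * (r + 2 * a) * l) + (r + 2 * a) * Y x) by lra.
  by rewrite ler_expR; have := ler_wpM2l a0 (ltW Yr2); lra.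
pose L := expR (l * ((r + a) ^+ 2 / 2 - k)).
(* Both complements of the window lead to this same exponent, which lies below that of L by l (a^2 /
   2 - 2 k). So each complement carries at most a quarter of L, and the window at least half. *)
have L_ge (x : R) : x = l * (a * r + r ^+ 2 / 2 + k) -> 4 * expR x <= L.
  move=> ->; apply: le_trans (ler_wpM2r (expR_ge0 _) h4) _.
  by rewrite -expRD ler_expR le_eqVlt; apply/orP; left; apply/eqP; field.
have t2 : 4 * (e2 * Ex w (fun x => expR (r * Y x))) <= L.
  apply: le_trans (L_ge (a * r * l + l * (r ^+ 2 / 2 + k)) _); last by ring.
  by rewrite ler_wpM2l// expRD ler_wpM2l// expR_ge0.
have t3 : 4 * (e3 * Ex w (fun x => expR ((r + 2 * a) * Y x))) <= L.
  apply: le_trans (L_ge (- (a * (r + 2 * a) * l) + l * ((r + 2 * a) ^+ 2 / 2 + k)) _).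
    by rewrite ler_wpM2l// expRD ler_wpM2l// expR_ge0.
  by field.
have : 2^-1 * L <= e1 * Pr w (fun x => r * l < Y x).
  by move: hlow split_le t2 t3; rewrite -/L; lra.
move/(ler_wpM2l (expR_ge0 (- ((r + a) * (r + 2 * a) * l)))).
rewrite [X in _ <= X]mulrA -expRD addNr expR0 mul1r; apply: le_trans.
rewrite mulrCA -expRD ler_wpM2l ?invr_ge0// ler_expR le_eqVlt.
by apply/orP; left; apply/eqP; field.
Qed.

(** * Columns with bounded entries *)

Lemma leq_triple_half k : (1 < k)%N -> (k <= 3 * k./2)%N.
Proof.
rewrite -[X in (1 < X)%N -> (X <= _)%N]odd_double_half -addnn.
by case: (odd k); case: (k./2) => [|[|h]] //= _; lia.
Qed.

(* In the application [th] is (log p / n)^(1/2), hence [l] is log p, and [ka] is a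
   small constant. *)
Section bounded_columns.
Context {R : realType}.
Variables (V : finType) (w q : V -> R) (n : nat) (th ka B : R).

Definition col_pmf : {ffun 'I_n -> V} -> R := pow_pmf w.

Definition inner (c c' : {ffun 'I_n -> V}) : R := \sum_k q (c k) * q (c' k).

Definition total (c : {ffun 'I_n -> V}) : R := \sum_k q (c k).

Let m : R := Ex w q.
Let s : R := Ex w (fun a => q a ^+ 2).
Let l : R := n%:R * th ^+ 2.

Hypotheses (w_pmf : is_pmf w) (th_gt0 : 0 < th) (th_le : th <= ka).
Hypotheses (ka_le : ka <= 100^-1).
Hypotheses (q_le : forall a, `|q a| <= B) (B_ge1 : 1 <= B) (B_le : B ^+ 2 * th <= ka).
Hypotheses (m_le : `|m| <= ka * th) (s_le : `|s - 1| <= ka).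

Let ka_gt0 : 0 < ka. Proof. exact: lt_le_trans th_le. Qed.

Let s_bounds : 1 - ka <= s <= 1 + ka.
Proof. by move: s_le; rewrite ler_norml => /andP[]; lra. Qed.

Let m2_le : m ^+ 2 <= ka * th ^+ 2.
Proof.
have h : m ^+ 2 <= (ka * th) ^+ 2.
  by rewrite -[m ^+ 2]real_normK ?num_real// ler_sqr ?nnegrE ?mulr_ge0// ltW.
apply: le_trans h _; rewrite exprMn ler_wpM2r ?sqr_ge0// expr2.
by rewrite ler_piMl ?(ltW ka_gt0)//; move: ka_le; lra.
Qed.

Let th_le1 : th <= 1. Proof. by move: th_le ka_le; lra. Qed.

Let qq_le a b : `|q a * q b| <= B ^+ 2.
Proof. by rewrite normrM expr2 ler_pM. Qed.

Lemma Ex_cross : Ex (prod_pmf w w) (fun a => q a.1 * q a.2) = m ^+ 2.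
Proof.
rewrite Ex_prod /=; under eq_Ex => a do rewrite ExZ.
by rewrite ExZr expr2.
Qed.

Lemma Ex_cross_sqr : Ex (prod_pmf w w) (fun a => (q a.1 * q a.2) ^+ 2) = s ^+ 2.
Proof.
rewrite Ex_prod /=.
under eq_Ex => a do under eq_Ex => b do rewrite exprMn.
under eq_Ex => a do rewrite ExZ.
by rewrite ExZr expr2.
Qed.

Let th2_ge0 : 0 <= th ^+ 2. Proof. exact: sqr_ge0. Qed.

Let drift_le (x : R) : `|x| <= 3 -> `|x * th * m ^+ 2| <= 3 * ka * th ^+ 2.
Proof.
move=> x3; rewrite 2!normrM -mulrA -[leRHS]mulrA ler_pM// ?mulr_ge0//.
rewrite (gtr0_norm th_gt0) (ger0_norm (sqr_ge0 m)).
apply: le_trans m2_le; rewrite ler_piMl ?sqr_ge0//.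
Qed.

Let sqr_le9 (x : R) : `|x| <= 3 -> x ^+ 2 <= 9.
Proof.
move=> x3; rewrite -real_normK ?num_real//.
have -> : 9 = 3 ^+ 2 :> R by ring.
by rewrite ler_sqr ?nnegrE.
Qed.

(** Makes the exponents small enough for the quadratic expansion of the exponential. The range |x|
    <= 3 covers all later parameters: 2 and 3 in the Chernoff bounds, and up to r + 2 a in the
    tilting. *)
Let lamB x : `|x| <= 3 -> `|x * th| * B ^+ 2 <= 3 * ka.
Proof.
move=> x3; rewrite normrM (gtr0_norm th_gt0) -mulrA [th * _]mulrC.
by rewrite ler_pM// mulr_ge0 ?sqr_ge0// ltW.
Qed.

(** A product of two independent entries has mean m^2, of order at most ka th^2, and second moment
    s^2 close to 1. The constant 200 generously collects all errors proportional to ka. *)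
Lemma mgf_cross_le (x : R) : `|x| <= 3 ->
  Ex (prod_pmf w w) (fun a => expR (x * th * (q a.1 * q a.2))) <=
  expR (th ^+ 2 * (x ^+ 2 / 2 + 200 * ka)).
Proof.
move=> x3; have ww := prod_pmfP w_pmf w_pmf.
apply: le_trans (mgf_le ww (fun a => qq_le a.1 a.2) (lamB x3) _) _.
  by move: ka_le; lra.
rewrite Ex_cross Ex_cross_sqr ler_expR.
have h1 := le_trans (ler_norm _) (drift_le x3).
have h2 : (1 + 3 * ka) * s ^+ 2 <= 1 + 7 * ka.
  have : s ^+ 2 <= 1 + 3 * ka.
    by move: s_bounds ka_gt0 ka_le => /andP[? ?] ? ?; nra.
  by move: ka_gt0 ka_le; nra.
have h3 := sqr_le9 x3.
have h4 := ler_wpM2l (mulr_ge0 th2_ge0 (sqr_ge0 x)) h2.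
have h5 := ler_wpM2l (mulr_ge0 (ltW ka_gt0) th2_ge0) h3.
have h6 := mulr_ge0 (ltW ka_gt0) th2_ge0.
rewrite exprMn; lra.
Qed.

Lemma mgf_cross_ge (x : R) : 0 <= x <= 3 ->
  expR (th ^+ 2 * (x ^+ 2 / 2 - 200 * ka)) <=
  Ex (prod_pmf w w) (fun a => expR (x * th * (q a.1 * q a.2))).
Proof.
move=> /andP[x0 x3']; have x3 : `|x| <= 3 by rewrite ger0_norm.
have ww := prod_pmfP w_pmf w_pmf.
have ka3 : 3 * ka <= 1 by move: ka_le; lra.
apply: le_trans _ (mgf_ge ww (fun a => qq_le a.1 a.2) (lamB x3) ka3).
rewrite Ex_cross Ex_cross_sqr.
set u := x * th * m ^+ 2 + _.
have h1 := le_trans (ler_norm _) (drift_le x3).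
have h3 := sqr_le9 x3.
have x2 := sqr_ge0 x.
have d0 : 0 <= x * th * m ^+ 2 by rewrite mulr_ge0 ?sqr_ge0// mulr_ge0// ltW.
have [h2 h2'] : 1 - 6 * ka <= (1 - 3 * ka) * s ^+ 2 /\
    (1 - 3 * ka) * s ^+ 2 <= 1 + 7 * ka.
  have [hs hs'] : 1 - 2 * ka <= s ^+ 2 /\ s ^+ 2 <= 1 + 3 * ka.
    by move: s_bounds ka_gt0 ka_le => /andP[? ?] ? ?; split; nra.
  by move: ka_gt0 ka_le => ? ?; split; nra.
have h4 := ler_wpM2l (mulr_ge0 th2_ge0 x2) h2.
have h4' := ler_wpM2l (mulr_ge0 th2_ge0 x2) h2'.
have h5 := ler_wpM2l (mulr_ge0 (ltW ka_gt0) th2_ge0) h3.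
have h5' := ler_wpM2l th2_ge0 h3.
have h6 := mulr_ge0 (ltW ka_gt0) th2_ge0.
have h7 : 0 <= th ^+ 2 * x ^+ 2 by rewrite mulr_ge0.
have h8 : ka * th ^+ 2 <= 100^-1 * th ^+ 2 by rewrite ler_wpM2r.
have ulow : th ^+ 2 * (x ^+ 2 / 2) - 27 * (ka * th ^+ 2) <= u.
  by rewrite /u exprMn; lra.
have u0 : 0 <= u.
  have : 0 <= th ^+ 2 * x ^+ 2 * (1 - 6 * ka).
    by rewrite mulr_ge0//; move: ka_le; lra.
  by rewrite /u exprMn; lra.
have uup : u <= 40 * th ^+ 2 by rewrite /u exprMn; lra.
(* The exponent is u / (1 + u) >= u - u^2. As u is at most 40 th^2 and th^2 is at most ka / 100, the
   loss u^2 is again of order ka th^2. *)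
apply: le_trans _ (expR_frac_le u0); rewrite ler_expR.
have -> : u / (1 + u) = u - u ^+ 2 / (1 + u) by field; lra.
have uu : u ^+ 2 / (1 + u) <= u ^+ 2.
  by rewrite ler_pdivrMr; [rewrite ler_peMr ?sqr_ge0//|]; lra.
have : u ^+ 2 <= 16 * (ka * th ^+ 2).
  have : u ^+ 2 <= (40 * th ^+ 2) ^+ 2 by rewrite ler_sqr ?nnegrE//; lra.
  have : th ^+ 2 * th ^+ 2 <= 100^-1 * ka * th ^+ 2.
    rewrite ler_wpM2r// expr2 ler_pM ?(ltW th_gt0)//.
    by move: th_le ka_le; lra.
  by rewrite exprMn; lra.
lra.
Qed.

(** The second moment 2 s^2 + 2 s m^2 is close to 2, so the exponent is x^2 instead of x^2 / 2. The
    summands are bounded by 2 B^2, hence the relative error 6 ka. *)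
Lemma mgf_star_le (x : R) : `|x| <= 2 ->
  Ex (prod_pmf w (prod_pmf w w))
    (fun a => expR (x * th * (q a.1 * (q a.2.1 + q a.2.2)))) <=
  expR (th ^+ 2 * (x ^+ 2 + 200 * ka)).
Proof.
move=> x2; have x3 : `|x| <= 3 by lra.
have ww := prod_pmfP w_pmf (prod_pmfP w_pmf w_pmf).
have bound (a : V * (V * V)) : `|q a.1 * (q a.2.1 + q a.2.2)| <= 2 * B ^+ 2.
  by rewrite mulrDr mulrDl mul1r (le_trans (ler_normD _ _))// lerD.
apply: le_trans (mgf_le ww bound (dlt := 6 * ka) _ _) _.
- by have := lamB x3; lra.
- by move: ka_le; lra.
have -> : Ex (prod_pmf w (prod_pmf w w)) (fun a => q a.1 * (q a.2.1 + q a.2.2)) =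
    2 * m ^+ 2.
  rewrite Ex_prod /=; under eq_Ex => a do rewrite ExZ ExD !Ex_prod /=.
  under eq_Ex => a do under [X in X + _]eq_Ex => b do rewrite Ex_cst//.
  rewrite ExZr (Ex_cst w_pmf) expr2 -/m; ring.
have -> : Ex (prod_pmf w (prod_pmf w w))
    (fun a => (q a.1 * (q a.2.1 + q a.2.2)) ^+ 2) = 2 * s ^+ 2 + 2 * s * m ^+ 2.
  rewrite Ex_prod /=; under eq_Ex => a.
    under eq_Ex => b do rewrite exprMn.
    rewrite ExZ; over.
  rewrite ExZr -/s; have -> : Ex (prod_pmf w w) (fun b => (q b.1 + q b.2) ^+ 2) =
      2 * s + 2 * m ^+ 2.
    transitivity (Ex (prod_pmf w w) (fun b => q b.1 ^+ 2 + q b.2 ^+ 2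
        + 2 * (q b.1 * q b.2))); first by apply: eq_Ex => b; ring.
    rewrite !ExD ExZ Ex_cross !Ex_prod /=.
    under eq_Ex => a do rewrite Ex_cst//.
    by rewrite (Ex_cst w_pmf) -/s; ring.
  by ring.
rewrite ler_expR.
have h1 := le_trans (ler_norm _) (drift_le x3).
have h2 : (1 + 6 * ka) * (s ^+ 2 + s * m ^+ 2) <= 1 + 12 * ka.
  have [sl sr] := andP s_bounds.
  have hs : s ^+ 2 <= 1 + 3 * ka.
    by move: ka_gt0 ka_le => ? ?; nra.
  have hm : m ^+ 2 <= ka / 100.
    apply: le_trans m2_le _; rewrite ler_wpM2l ?(ltW ka_gt0)//.
    have : th ^+ 2 <= th by rewrite expr2 ler_piMl// ltW.
    by move: th_le ka_le; lra.
  have hsm : s * m ^+ 2 <= 2 * (ka / 100).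
    by rewrite ler_pM ?sqr_ge0//; move: ka_le; lra.
  have : s ^+ 2 + s * m ^+ 2 <= 1 + 4 * ka by move: ka_gt0; lra.
  by move: ka_gt0 ka_le; nra.
have h3 := sqr_le9 x3.
have h4 := ler_wpM2l (mulr_ge0 th2_ge0 (sqr_ge0 x)) h2.
have h5 := ler_wpM2l (mulr_ge0 (ltW ka_gt0) th2_ge0) h3.
have h6 := mulr_ge0 (ltW ka_gt0) th2_ge0.
rewrite exprMn; lra.
Qed.

Lemma mgf_single_le (x : R) : `|x| <= 3 ->
  Ex w (fun a => expR (x * th * q a)) <= expR (th ^+ 2 * (x ^+ 2 / 2 + 200 * ka)).
Proof.
(* Since B >= 1, the cruder bound B^2 on a single entry allows [lamB] to be reused. *)
move=> x3; have BB : B <= B ^+ 2 by rewrite expr2 ler_peMr//; move: B_ge1; lra.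
apply: le_trans (mgf_le w_pmf (M := B ^+ 2) _ (lamB x3) _) _.
- by move=> a; apply: le_trans BB.
- by move: ka_le; lra.
rewrite -/m -/s ler_expR.
have h1 : x * th * m <= 3 * ka * th ^+ 2.
  apply: le_trans (ler_norm _) _; rewrite normrM.
  have -> : 3 * ka * th ^+ 2 = (3 * th) * (ka * th) by ring.
  by rewrite ler_pM// normrM (gtr0_norm th_gt0) ler_wpM2r// ltW.
have h2 : (1 + 3 * ka) * s <= 1 + 7 * ka.
  by move: s_bounds ka_gt0 ka_le => /andP[? ?] ? ?; nra.
have h3 := sqr_le9 x3.
have h4 := ler_wpM2l (mulr_ge0 th2_ge0 (sqr_ge0 x)) h2.
have h5 := ler_wpM2l (mulr_ge0 (ltW ka_gt0) th2_ge0) h3.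
have h6 := mulr_ge0 (ltW ka_gt0) th2_ge0.
rewrite exprMn; lra.
Qed.

(** The exponent is only of first order in th: the fourth moment may be as large as B^2 s, and th^2
    B^2 is at most ka th. This is enough because norms only need control up to a fixed proportion of
    n. *)
Lemma mgf_sqr_le (x : R) : `|x| = 1 ->
  Ex w (fun a => expR (x * th * (q a ^+ 2 - 1))) <= expR (4 * ka * th).
Proof.
move=> x1.
have -> : Ex w (fun a => expR (x * th * (q a ^+ 2 - 1))) =
    expR (- (x * th)) * Ex w (fun a => expR (x * th * q a ^+ 2)).
  by rewrite -ExZ; apply: eq_Ex => a; rewrite -expRD; congr expR; ring.
have x3 : `|x| <= 3 by rewrite x1; lra.
have q2 a : `|q a ^+ 2| <= B ^+ 2 by rewrite expr2 qq_le.
apply: le_trans (ler_wpM2l (expR_ge0 _) (mgf_le w_pmf q2 (lamB x3) _)) _.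
  by move: ka_le; lra.
rewrite -/s -expRD ler_expR.
have h1 : x * th * (s - 1) <= th * ka.
  by apply: le_trans (ler_norm _) _; rewrite !normrM x1 mul1r (gtr0_norm th_gt0) ler_wpM2l// ltW.
have h2 : Ex w (fun a => (q a ^+ 2) ^+ 2) <= B ^+ 2 * s.
  rewrite -ExZ; apply: le_Ex => // a; rewrite expr2 ler_wpM2r ?sqr_ge0//.
  exact: le_trans (ler_norm _) (q2 a).
have h3 : (x * th) ^+ 2 = th * th by rewrite exprMn -(real_normK (num_real x)) x1 expr1n mul1r.
rewrite h3.
have h4 : th * Ex w (fun a => (q a ^+ 2) ^+ 2) <= ka * s.
  apply: le_trans (ler_wpM2l (ltW th_gt0) h2) _.
  rewrite mulrA [th * _]mulrC ler_wpM2r//.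
  by move: s_bounds ka_le => /andP[? ?] ?; lra.
have h5 : ka * s <= 2 * ka.
  by move: s_bounds ka_gt0 ka_le => /andP[? ?] ? ?; nra.
have h6 : (1 + 3 * ka) * (th * Ex w (fun a => (q a ^+ 2) ^+ 2)) <= 4 * ka.
  by move: ka_gt0 ka_le => ? ?; nra.
have := ler_wpM2l (ltW th_gt0) h6; move: (mulr_gt0 ka_gt0 th_gt0).
lra.
Qed.

Lemma mgf_innerE (x : R) :
  Ex (prod_pmf col_pmf col_pmf) (fun c => expR (x * (th * inner c.1 c.2))) =
  Ex (prod_pmf w w) (fun a => expR (x * th * (q a.1 * q a.2))) ^+ n.
Proof.
transitivity (\prod_(k < n) Ex (prod_pmf w w)
    (fun a => expR (x * th * (q a.1 * q a.2)))); last first.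
  by rewrite prodr_const card_ord.
rewrite -(Ex_pow2_prod w (fun k a b => expR (x * th * (q a * q b)))).
by apply: eq_Ex => c; rewrite -expR_sum -mulr_sumr mulrA.
Qed.

Lemma mgf_inner_le (x : R) : `|x| <= 3 ->
  Ex (prod_pmf col_pmf col_pmf) (fun c => expR (x * (th * inner c.1 c.2))) <=
  expR (l * (x ^+ 2 / 2 + 200 * ka)).
Proof.
move=> x3; rewrite mgf_innerE -mulrA expRM_natl lerXn2r ?nnegrE ?expR_ge0//.
  by apply: Ex_ge0 => [|a]; [exact: prod_pmfP | exact: expR_ge0].
exact: mgf_cross_le.
Qed.

Lemma mgf_inner_ge (x : R) : 0 <= x <= 3 ->
  expR (l * (x ^+ 2 / 2 - 200 * ka)) <=
  Ex (prod_pmf col_pmf col_pmf) (fun c => expR (x * (th * inner c.1 c.2))).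
Proof.
move=> x3; rewrite mgf_innerE -mulrA expRM_natl lerXn2r ?nnegrE ?expR_ge0//.
  by apply: Ex_ge0 => [|a]; [exact: prod_pmfP | exact: expR_ge0].
exact: mgf_cross_ge.
Qed.

Let col_pmfP : is_pmf col_pmf. Proof. exact: pow_pmfP. Qed.

Let pairP : is_pmf (prod_pmf col_pmf col_pmf). Proof. exact: prod_pmfP. Qed.

Let l_ge0 : 0 <= l. Proof. by rewrite /l mulr_ge0. Qed.

Let ka200 : 200 * ka <= 2. Proof. by move: ka_le; lra. Qed.

Lemma Pr_normr_gt_le (A : finType) (w' X : A -> R) (t e : R) : is_pmf w' ->
  expR (- t) * Ex w' (fun a => expR (X a)) <= e ->
  expR (- t) * Ex w' (fun a => expR (- X a)) <= e ->
  Pr w' (fun a => t < `|X a|) <= 2 * e.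
Proof.
move=> w'P h1 h2.
have c (Y : A -> R) : Pr w' (fun a => t < Y a) <= expR (- t) * Ex w' (fun a => expR (Y a)).
  have := Pr_gt_chernoff w'P Y t ler01; rewrite mul1r => h.
  by apply: le_trans h _; rewrite le_eqVlt (eq_Ex _
    (g := fun a => expR (Y a))) ?eqxx// => a; rewrite mul1r.
apply: (@le_trans _ _ (Pr w' (fun a => (t < X a) || (t < - X a)))).
  by apply: le_Pr => // a; rewrite ltr_normr.
apply: le_trans (Pr_or_le w'P _ _) _.
have := le_trans (c X) h1; have := le_trans (c (fun a => - X a)) h2; lra.
Qed.

(** Chernoff's bound with parameter 2 gives the exponent - 2 (2 + e) + 2 + 200 ka, at most - (2 +
    e); this beats the exp (2 l) pairs of columns. *)
Lemma Pr_inner_gt (e : R) : 200 * ka <= e ->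
  Pr (prod_pmf col_pmf col_pmf) (fun c => (2 + e) * l < `|th * inner c.1 c.2|) <=
  2 * expR (- (l * (2 + e))).
Proof.
move=> ke.
(* The Chernoff parameter is moved into the random variable, so that the two-sided bound
   [Pr_normr_gt_le] applies. *)
have -> : Pr (prod_pmf col_pmf col_pmf) (fun c => (2 + e) * l < `|th * inner c.1 c.2|) =
    Pr (prod_pmf col_pmf col_pmf)
      (fun c => 2 * (2 + e) * l < `|2 * (th * inner c.1 c.2)|).
  apply: eq_Ex => c; congr (_%:R); rewrite [in RHS]normrM ger0_norm//.
  by rewrite -[in RHS]mulrA ltr_pM2l.
have ex : expR (- (2 * (2 + e) * l)) * expR (l * (2 ^+ 2 / 2 + 200 * ka)) <=
    expR (- (l * (2 + e))).
  by rewrite -expRD ler_expR; have := ler_wpM2l l_ge0 ke; lra.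
apply: Pr_normr_gt_le => //; apply: le_trans ex; rewrite ler_wpM2l ?expR_ge0//.
  by apply: mgf_inner_le; rewrite ger0_norm//; lra.
rewrite -[2 ^+ 2]sqrrN; apply: le_trans (mgf_inner_le _).
  by rewrite le_eqVlt (eq_Ex _
    (g := fun c => expR (- 2 * (th * inner c.1 c.2)))) ?eqxx// => c; rewrite mulNr.
by rewrite normrN ger0_norm//; lra.
Qed.

(** With parameter 3 the exponent is at most - 9 + 9 / 2 + 2 < - 2, more than enough for a union
    bound over exp l columns. *)
Lemma Pr_total_gt : Pr col_pmf (fun c => 3 * l < `|th * total c|) <=
  2 * expR (- (2 * l)).
Proof.
have mgf (x : R) : `|x| <= 3 ->
    Ex col_pmf (fun c => expR (x * (th * total c))) <= expR (l * (x ^+ 2 / 2 + 200 * ka)).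
  move=> x3.
  have -> : Ex col_pmf (fun c => expR (x * (th * total c))) =
      Ex w (fun a => expR (x * th * q a)) ^+ n.
    transitivity (\prod_(k < n) Ex w (fun a => expR (x * th * q a))); last first.
      by rewrite prodr_const card_ord.
    rewrite -(Ex_pow_prod w (fun k a => expR (x * th * q a))); apply: eq_Ex => c.
    by rewrite -expR_sum /total mulrA mulr_sumr.
  rewrite -mulrA expRM_natl lerXn2r ?nnegrE ?expR_ge0//.
    by apply: Ex_ge0 => // a; exact: expR_ge0.
  exact: mgf_single_le.
have -> : Pr col_pmf (fun c => 3 * l < `|th * total c|) =
    Pr col_pmf (fun c => 3 * (3 * l) < `|3 * (th * total c)|).
  apply: eq_Ex => c; congr (_%:R); rewrite [in RHS]normrM ger0_norm//.
  by rewrite ltr_pM2l.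
have ex : expR (- (3 * (3 * l))) * expR (l * (3 ^+ 2 / 2 + 200 * ka)) <=
    expR (- (2 * l)).
  by rewrite -expRD ler_expR; have := ler_wpM2l l_ge0 ka200; move: l_ge0; lra.
apply: Pr_normr_gt_le => //; apply: le_trans ex; rewrite ler_wpM2l ?expR_ge0//.
  by apply: mgf; rewrite ger0_norm.
rewrite -[3 ^+ 2]sqrrN; apply: le_trans (mgf _ _).
  by rewrite le_eqVlt (eq_Ex _
    (g := fun c => expR (- 3 * (th * total c)))) ?eqxx// => c; rewrite mulNr.
by rewrite normrN ger0_norm.
Qed.

Lemma Pr_norm_gt (tau : R) : 6 * ka <= tau ->
  Pr col_pmf (fun c => tau * n%:R < `|inner c c - n%:R|) <= 2 * expR (- (2 * l)).
Proof.
move=> ktau.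
have mgf (x : R) : `|x| = 1 ->
    Ex col_pmf (fun c => expR (x * (th * (inner c c - n%:R)))) <=
    expR (n%:R * (4 * ka * th)).
  move=> x1.
  have -> : Ex col_pmf (fun c => expR (x * (th * (inner c c - n%:R)))) =
      Ex w (fun a => expR (x * th * (q a ^+ 2 - 1))) ^+ n.
    transitivity (\prod_(k < n) Ex w (fun a => expR (x * th * (q a ^+ 2 - 1)))); last first.
      by rewrite prodr_const card_ord.
    rewrite -(Ex_pow_prod w (fun k a => expR (x * th * (q a ^+ 2 - 1)))).
    apply: eq_Ex => c; rewrite -expR_sum -mulr_sumr sumrB sumr_const card_ord.
    by rewrite mulrA /inner.
  rewrite expRM_natl lerXn2r ?nnegrE ?expR_ge0//.
    by apply: Ex_ge0 => // a; exact: expR_ge0.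
  exact: mgf_sqr_le.
have -> : Pr col_pmf (fun c => tau * n%:R < `|inner c c - n%:R|) =
    Pr col_pmf (fun c => th * (tau * n%:R) < `|th * (inner c c - n%:R)|).
  apply: eq_Ex => c; congr (_%:R); rewrite [in RHS]normrM gtr0_norm//.
  by rewrite ltr_pM2l.
(* By tau >= 6 ka the exponent is at most - 2 ka th n, and th <= ka turns this into - 2 n th^2 = - 2
   l. *)
have ex : expR (- (th * (tau * n%:R))) * expR (n%:R * (4 * ka * th)) <=
    expR (- (2 * l)).
  rewrite -expRD ler_expR /l.
  have n0 : (0 : R) <= n%:R by [].
  have h1 := ler_wpM2l (mulr_ge0 n0 (ltW th_gt0)) th_le.
  have h2 := ler_wpM2l (mulr_ge0 n0 (ltW th_gt0)) ktau.
  by rewrite expr2; lra.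
apply: Pr_normr_gt_le => //; apply: le_trans ex; rewrite ler_wpM2l ?expR_ge0//.
  apply: le_trans (mgf 1 (normr1 _)).
  by rewrite le_eqVlt (eq_Ex _
    (g := fun c => expR (1 * (th * (inner c c - n%:R))))) ?eqxx// => c; rewrite mul1r.
apply: le_trans (mgf (- 1) _); last by rewrite normrN1.
by rewrite le_eqVlt (eq_Ex _
    (g := fun c => expR (- 1 * (th * (inner c c - n%:R))))) ?eqxx// => c; rewrite mulN1r.
Qed.

Lemma Pr_inner_gt_ge (r a : R) : 0 <= r -> 0 <= a -> r + 2 * a <= 3 ->
  4 <= expR (l * (a ^+ 2 / 2 - 2 * (200 * ka))) ->
  2^-1 * expR (- (l * ((r + a) * (r + 3 * a) / 2 + 200 * ka))) <=
  Pr (prod_pmf col_pmf col_pmf) (fun c => r * l < th * inner c.1 c.2).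
Proof.
move=> r0 a0 ra h4; apply: Pr_gt_tilting => //.
- by apply: mgf_inner_ge; lra.
- by apply: mgf_inner_le; rewrite ger0_norm; lra.
- by apply: mgf_inner_le; rewrite ger0_norm; lra.
Qed.

(** If both inner products exceed the level, their sum exceeds twice the level. Chernoff's bound
    with parameter r then has exponent - 2 r^2 + r^2 + 200 ka. *)
Lemma Pr_star_gt (r : R) : 0 <= r <= 2 ->
  Pr (prod_pmf col_pmf (prod_pmf col_pmf col_pmf))
    (fun c => (r * l < th * inner c.1 c.2.1) && (r * l < th * inner c.1 c.2.2)) <=
  expR (- (l * (r ^+ 2 - 200 * ka))).
Proof.
move=> /andP[r0 r2]; have starP := prod_pmfP col_pmfP pairP.
apply: (@le_trans _ _ (Pr (prod_pmf col_pmf (prod_pmf col_pmf col_pmf))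
  (fun c => 2 * (r * l) < th * (inner c.1 c.2.1 + inner c.1 c.2.2)))).
  by apply: le_Pr => // c /andP[? ?]; lra.
apply: le_trans (Pr_gt_chernoff starP _ _ r0) _.
have -> : expR (- (l * (r ^+ 2 - 200 * ka))) =
    expR (- (r * (2 * (r * l)))) * expR (l * (r ^+ 2 + 200 * ka)).
  by rewrite -expRD; congr expR; ring.
rewrite ler_wpM2l ?expR_ge0//.
have -> : Ex (prod_pmf col_pmf (prod_pmf col_pmf col_pmf))
    (fun c => expR (r * (th * (inner c.1 c.2.1 + inner c.1 c.2.2)))) =
    Ex (prod_pmf w (prod_pmf w w))
      (fun a => expR (r * th * (q a.1 * (q a.2.1 + q a.2.2)))) ^+ n.
  transitivity (\prod_(k < n) Ex (prod_pmf w (prod_pmf w w))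
      (fun a => expR (r * th * (q a.1 * (q a.2.1 + q a.2.2))))); last first.
    by rewrite prodr_const card_ord.
  rewrite -(Ex_pow3_prod w (fun k a b c => expR (r * th * (q a * (q b + q c))))).
  apply: eq_Ex => c; rewrite -expR_sum -mulr_sumr mulrA /inner -big_split/=.
  by under [in RHS]eq_bigr do rewrite mulrDr.
rewrite -mulrA expRM_natl lerXn2r ?nnegrE ?expR_ge0//.
  by apply: Ex_ge0 => [|a]; [do !apply: prod_pmfP | exact: expR_ge0].
by apply: mgf_star_le; rewrite ger0_norm.
Qed.

(** * Union bounds and the second moment method over all columns *)

Section columns_coherence.
Variables (p : nat) (eps : R).

(** The complement provides what the deterministic estimate of the coherence asks for. The last
    alternative concerns signed inner products: one large positive value suffices for the lower
    bound. *)
Definition atypical (v : {ffun 'I_p -> {ffun 'I_n -> V}}) : bool :=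
  [|| [exists i, 3 * l < `|th * total (v i)|],
      [exists i, eps / 100 * n%:R < `|inner (v i) (v i) - n%:R|],
      [exists ij : 'I_p * 'I_p, (ij.1 < ij.2)%N &&
        ((2 + eps) * l < `|th * inner (v ij.1) (v ij.2)|)] |
      [forall ij : 'I_p * 'I_p, (ij.1 < ij.2)%N ==>
        (th * inner (v ij.1) (v ij.2) <= (2 - eps) * l)]].

Hypotheses (eps_gt0 : 0 < eps) (eps_le1 : eps <= 1).
Hypotheses (ka_le_eps : ka <= (eps / 1000) ^+ 2).
Hypotheses (l_eq : expR l = p%:R) (l_large : 4 <= expR (l * (eps / 32) ^+ 2)).

Let ka_eps : 1000 * (1000 * ka) <= eps ^+ 2.
Proof. by move: ka_le_eps; rewrite exprMn; lra. Qed.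

Let eps2_le : eps ^+ 2 <= eps.
Proof. by rewrite expr2 ler_piMl// ltW. Qed.

Let p_ge4 : (4 <= p)%N.
Proof.
rewrite -(ler_nat R) -l_eq; apply: le_trans l_large _; rewrite ler_expR.
apply: ler_piMr => //; move: eps2_le eps_le1; rewrite exprMn; lra.
Qed.

Let p_mul (x y : R) : y = l + x -> p%:R * expR x = expR y.
Proof. by move=> ->; rewrite -l_eq expRD. Qed.

Let expR_le_small (x : R) : x <= - (l * (eps / 4)) ->
  expR x <= expR (- (l * (eps / 4))).
Proof. by rewrite ler_expR. Qed.

Let le_half : l * (eps / 4) <= l * 4^-1.
Proof. by rewrite ler_wpM2l//; move: eps_le1; lra. Qed.

Let l_eps_ge0 : 0 <= l * eps.
Proof. by rewrite mulr_ge0// ltW. Qed.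

Let Pr_column_le (Q : pred {ffun 'I_n -> V}) : Pr col_pmf Q <= 2 * expR (- (2 * l)) ->
  Pr (pow_pmf col_pmf) (fun v : {ffun 'I_p -> {ffun 'I_n -> V}} => [exists i, Q (v i)]) <=
  2 * expR (- (l * (eps / 4))).
Proof.
move=> hQ; have powP := pow_pmfP 'I_p col_pmfP.
apply: (@le_trans _ _ (\sum_(i < p) Pr col_pmf Q)).
  rewrite (eq_bigr (fun i => Pr (pow_pmf col_pmf) (fun v : {ffun 'I_p -> {ffun 'I_n -> V}} => Q (v i)))).
    exact: (Pr_exists_le powP xpredT (fun i v => Q (v i))).
  by move=> i _; rewrite /Pr (Ex_marginal1 col_pmfP i (fun a => (Q a)%:R)).
rewrite sumr_const card_ord -[_ *+ p]mulr_natl.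
apply: le_trans (ler_wpM2l _ hQ) _; first exact: ler0n.
rewrite mulrCA (p_mul (y := - l)); last by ring.
by rewrite ler_wpM2l// expR_le_small//; move: le_half l_ge0; lra.
Qed.

Let Pr_pair_le :
  Pr (pow_pmf col_pmf) (fun v : {ffun 'I_p -> {ffun 'I_n -> V}} => [exists ij : 'I_p * 'I_p,
     (ij.1 < ij.2)%N && ((2 + eps) * l < `|th * inner (v ij.1) (v ij.2)|)]) <=
  2 * expR (- (l * (eps / 4))).
Proof.
have powP := pow_pmfP 'I_p col_pmfP.
pose Q (a b : {ffun 'I_n -> V}) := (2 + eps) * l < `|th * inner a b|.
apply: le_trans (Pr_exists_le powP (fun ij : 'I_p * 'I_p => (ij.1 < ij.2)%N)
  (fun ij v => Q (v ij.1) (v ij.2))) _.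
have ke : 200 * ka <= eps by move: ka_eps eps2_le ka_gt0; lra.
(* Enlarging the sum to all p^2 = exp (2 l) ordered pairs leaves exp (- l eps). *)
apply: (@le_trans _ _ (\sum_(ij : 'I_p * 'I_p) 2 * expR (- (l * (2 + eps))))).
  rewrite [leRHS](bigID (fun ij : 'I_p * 'I_p => (ij.1 < ij.2)%N))/=.
  rewrite -[leLHS]addr0 lerD//; last by rewrite sumr_ge0// => *; rewrite mulr_ge0// expR_ge0.
  apply: ler_sum => -[i j] /= ij.
  rewrite /Pr (Ex_marginal2 col_pmfP (fun a b => (Q a b)%:R)); last first.
    by rewrite neq_ltn ij.
  by rewrite -(Ex_prod _ _ (fun c => (Q c.1 c.2)%:R)); exact: Pr_inner_gt.
rewrite sumr_const card_prod card_ord -[_ *+ (p * p)]mulr_natl natrM mulrCA.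
rewrite -mulrA (p_mul (y := - (l * (1 + eps)))); last by ring.
rewrite (p_mul (y := - (l * eps))); last by ring.
by rewrite ler_wpM2l// expR_le_small//; move: l_eps_ge0; lra.
Qed.

(** Second moment method with the lower bound on [al] from tilting, the star bound on [bt], and two
    index sets of size about p / 2. Its two terms contribute 24 and 18 to the constant 42. *)
Let Pr_no_pair_le :
  Pr (pow_pmf col_pmf) (fun v : {ffun 'I_p -> {ffun 'I_n -> V}} => [forall ij : 'I_p * 'I_p,
     (ij.1 < ij.2)%N ==> (th * inner (v ij.1) (v ij.2) <= (2 - eps) * l)]) <=
  42 * expR (- (l * (eps / 4))).
Proof.
have powP := pow_pmfP 'I_p col_pmfP.
pose Q (c c' : {ffun 'I_n -> V}) := (2 - eps) * l < th * inner c c'.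
have Q_sym c c' : Q c c' = Q c' c.
  by rewrite /Q /inner; under eq_bigr do rewrite mulrC.
(* J consists of the first M indices and K of the next M, so i < j holds for all i in J and j in
   K. *)
pose M := p./2; have MMp : (M + M <= p)%N by rewrite addnn -[leqRHS]odd_double_half leq_addl.
have M0 : (0 < M)%N by rewrite half_gt0 (leq_trans _ p_ge4).
pose e0 (i : 'I_M) : 'I_p := widen_ord MMp (lshift M i).
pose e1 (i : 'I_M) : 'I_p := widen_ord MMp (rshift M i).
have e0_inj : injective e0 by move=> i j /(congr1 val)/= ij; exact: val_inj.
have e1_inj : injective e1.
  by move=> i j /(congr1 val)/= /addnI ij; exact: val_inj.
pose J := [set e0 i | i in 'I_M]; pose K := [set e1 i | i in 'I_M].
have JK i j : i \in J -> j \in K -> (i < j)%N.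
  move=> /imsetP[i' _ ->] /imsetP[j' _ ->] /=.
  by rewrite (leq_trans (ltn_ord i'))// leq_addr.
have disJK : [disjoint J & K].
  by apply/pred0P => i /=; apply/negP => /andP[iJ iK]; have := JK i i iJ iK; rewrite ltnn.
have cardJ : #|J| = M by rewrite card_imset// card_ord.
have cardK : #|K| = M by rewrite card_imset// card_ord.
(* The cost 4 r a of tilting is then below eps / 2, while a^2 / 2 - 400 ka still exceeds (eps /
   32)^2, so that [l_large] gives the tilting condition. *)
pose r := 2 - eps; pose a := eps / 16.
set al := Pr (prod_pmf col_pmf col_pmf) (fun c => Q c.1 c.2).
have e21 : a ^+ 2 = eps ^+ 2 / 256 by rewrite /a exprMn; congr (_ * _); field.
have al_ge : 2^-1 * expR (- (l * ((r + a) * (r + 3 * a) / 2 + 200 * ka))) <= al.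
  apply: Pr_inner_gt_ge; rewrite ?/r ?/a.
  - by move: eps_le1; lra.
  - by move: eps_gt0; lra.
  - by move: eps_gt0; lra.
  - apply: le_trans l_large _; rewrite ler_expR ler_wpM2l//.
    by rewrite -/a e21 exprMn; move: ka_eps (sqr_ge0 eps); lra.
set x := l * ((r + a) * (r + 3 * a) / 2 + 200 * ka) in al_ge.
have al0 : 0 < al by apply: lt_le_trans al_ge; rewrite mulr_gt0 ?expR_gt0.
have ali : al^-1 <= 2 * expR x.
  rewrite -[leRHS]invrK lef_pV2 ?posrE ?invr_gt0 ?mulr_gt0 ?expR_gt0//.
  by rewrite invfM -expRN.
have bt_le : Pr (prod_pmf col_pmf (prod_pmf col_pmf col_pmf))
    (fun c => Q c.1 c.2.1 && Q c.1 c.2.2) <= expR (- (l * (r ^+ 2 - 200 * ka))).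
  by apply: Pr_star_gt; rewrite /r; move: eps_le1 eps_gt0; lra.
set bt := Pr _ _ in bt_le.
have bt0 : 0 <= bt by apply: Pr_ge0; do !apply: prod_pmfP.
have Mi : M%:R^-1 <= 3 * expR (- l).
  have -> : expR (- l) = p%:R^-1 by rewrite expRN l_eq.
  have p0n : (0 < p)%N by rewrite (leq_trans _ p_ge4).
  rewrite -[leRHS]invrK lef_pV2 ?posrE ?invr_gt0 ?mulr_gt0 ?invr_gt0 ?ltr0n//.
  rewrite invfM invrK mulrC ler_pdivrMr// -natrM ler_nat.
  by rewrite mulnC; apply: leq_triple_half; rewrite (leq_trans _ p_ge4).
have Mi0 : 0 <= M%:R^-1 :> R by rewrite invr_ge0.
have := second_moment_bound col_pmfP Q_sym disJK M0 cardJ cardK al0.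
rewrite -/al -/bt => h.
apply: (@le_trans _ _ (Pr (pow_pmf col_pmf) (fun v : {ffun 'I_p -> {ffun 'I_n -> V}} =>
   [forall i in J, forall j in K, ~~ Q (v i) (v j)]))).
  apply: le_Pr => // v /forallP vQ; apply/forall_inP => i iJ.
  apply/forall_inP => j jK; rewrite -leNgt.
  by have /implyP/(_ (JK _ _ iJ jK)) := vQ (i, j).
apply: le_trans h _.
(* Up to constants, bt / al^2 is at most exp (l eps / 2), against a factor exp (- l) from 1 / M. *)
have t1 : 2 * bt / (M%:R * al ^+ 2) <= 24 * expR (- (l * (eps / 4))).
  have -> : 2 * bt / (M%:R * al ^+ 2) = 2 * (bt * (M%:R^-1 * (al^-1 * al^-1))).
    by field; rewrite !gt_eqF// ltr0n.
  have ali0 : 0 <= al^-1 by rewrite invr_ge0 ltW.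
  have h1 : bt * (M%:R^-1 * (al^-1 * al^-1)) <=
      expR (- (l * (r ^+ 2 - 200 * ka))) * ((3 * expR (- l)) * ((2 * expR x) * (2 * expR x))).
    by rewrite ler_pM ?mulr_ge0// ler_pM ?mulr_ge0// ler_pM.
  have h2 : expR (- (l * (r ^+ 2 - 200 * ka))) * ((3 * expR (- l)) * ((2 * expR x) * (2 * expR x)))
      = 12 * expR (- (l * (r ^+ 2 - 200 * ka)) - l + x + x).
    by rewrite !expRD; ring.
  rewrite h2 in h1.
  have : expR (- (l * (r ^+ 2 - 200 * ka)) - l + x + x) <= expR (- (l * (eps / 4))).
    apply: expR_le_small.
    have : (r + a) * (r + 3 * a) + 600 * ka - r ^+ 2 - 1 <= - (eps / 4).
      have -> : (r + a) * (r + 3 * a) = r ^+ 2 + 4 * r * a + 3 * a ^+ 2 by ring.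
      have -> : 4 * r * a = eps / 2 - eps ^+ 2 / 4 by rewrite /r /a; field.
      by rewrite e21; move: ka_eps eps2_le eps_gt0 eps_le1 (sqr_ge0 eps); lra.
    by move/(ler_wpM2l l_ge0); rewrite /x; lra.
  by move: h1; lra.
(* To first order in eps, 1 / al is bounded by 2 exp (l (2 - 7 eps / 4)), against exp (- 2 l) from 1
   / M^2. *)
have t2 : (M%:R ^+ 2 * al)^-1 <= 18 * expR (- (l * (eps / 4))).
  have -> : (M%:R ^+ 2 * al)^-1 = M%:R^-1 * M%:R^-1 * al^-1.
    by field; rewrite !gt_eqF// ltr0n.
  have h1 : M%:R^-1 * M%:R^-1 * al^-1 <= (3 * expR (- l)) * (3 * expR (- l)) * (2 * expR x).
    by rewrite ler_pM ?mulr_ge0 ?invr_ge0 ?(ltW al0)// ler_pM.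
  have h2 : (3 * expR (- l)) * (3 * expR (- l)) * (2 * expR x) = 18 * expR (- l - l + x).
    by rewrite !expRD; ring.
  rewrite h2 in h1; apply: le_trans h1 _; rewrite ler_wpM2l// expR_le_small//.
  have : (r + a) * (r + 3 * a) / 2 + 200 * ka - 2 <= - (eps / 4).
    have -> : (r + a) * (r + 3 * a) / 2 =
        2 - 2 * eps + eps ^+ 2 / 2 + (eps / 4 - eps ^+ 2 / 8) + 3 * (eps ^+ 2 / 256) / 2.
      by rewrite /r /a; field.
    by move: ka_eps eps2_le eps_gt0 eps_le1 (sqr_ge0 eps); lra.
  by move/(ler_wpM2l l_ge0); rewrite /x; lra.
by move: t1 t2; lra.
Qed.

Lemma Pr_atypical_le : Pr (pow_pmf col_pmf) atypical <= 48 * expR (- (l * (eps / 4))).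
Proof.
have powP := pow_pmfP 'I_p col_pmfP.
have tau_ge : 6 * ka <= eps / 100 by move: ka_eps eps2_le ka_gt0; lra.
have h1 := Pr_column_le Pr_total_gt.
have h2 := Pr_column_le (Pr_norm_gt tau_ge).
have h12 := lerD h1 (lerD h2 (lerD Pr_pair_le Pr_no_pair_le)).
have -> : 48 * expR (- (l * (eps / 4))) = 2 * expR (- (l * (eps / 4))) +
  (2 * expR (- (l * (eps / 4))) + (2 * expR (- (l * (eps / 4))) + 42 * expR (- (l * (eps / 4))))) by ring.
apply: le_trans _ h12; apply: le_trans (Pr_or_le powP _ _) _; rewrite lerD2l.
apply: le_trans (Pr_or_le powP _ _) _; rewrite lerD2l.
exact: le_trans (Pr_or_le powP _ _) _.
Qed.

End columns_coherence.

End bounded_columns.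

(** * Coherence from inner products *)

Section affine_data.
Context {R : realType} {n p : nat}.
Variables (X : 'M[R]_(n, p)) (y : 'I_n -> 'I_p -> R) (mu s : R).
Hypotheses (n_gt0 : (0 < n)%N) (s_gt0 : 0 < s).
Hypothesis X_eq : forall k i, X k i = s * y k i + mu.

Let S i j : R := \sum_k y k i * y k j.
Let U i : R := \sum_k y k i.
(** This is n times the empirical covariance of columns i and j of y. *)
Let D i j : R := S i j - U i * U j / n%:R.

Let nR_gt0 : (0 : R) < n%:R. Proof. by rewrite ltr0n. Qed.

Lemma centered_columnE i k : centered_column X i k 0 = s * (y k i - U i / n%:R).
Proof.
rewrite !mxE /column_mean; under eq_bigr do rewrite X_eq.
rewrite big_split/= -mulr_sumr sumr_const card_ord X_eq -/(U i).
by rewrite -[mu *+ n]mulr_natl; field; rewrite gt_eqF.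
Qed.

Lemma centered_column_dot i j :
  ((centered_column X i)^T *m centered_column X j) 0 0 = s ^+ 2 * D i j.
Proof.
rewrite mxE.
under eq_bigr => k _ do rewrite [X in X * _]mxE !centered_columnE.
transitivity (\sum_k (s ^+ 2 * (y k i * y k j) + (- s ^+ 2 * (U j / n%:R)) * y k i
   + (- s ^+ 2 * (U i / n%:R)) * y k j + s ^+ 2 * (U i / n%:R) * (U j / n%:R))).
  by apply: eq_bigr => k _; ring.
rewrite !big_split/= -!mulr_sumr sumr_const card_ord -/(S i j) -/(U i) -/(U j).
by rewrite -[_ *+ n]mulr_natl /D; field; rewrite gt_eqF.
Qed.

Lemma euclidean_norm_centered i :
  euclidean_norm (centered_column X i) = s * Num.sqrt (D i i).
Proof.
have -> : euclidean_norm (centered_column X i) = Num.sqrt (s ^+ 2 * D i i).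
  rewrite -centered_column_dot /euclidean_norm mxE; congr Num.sqrt.
  by apply: eq_bigr => k _; rewrite [X in _ = X * _]mxE expr2.
by rewrite sqrtrM ?sqr_ge0// sqrtr_sqr gtr0_norm.
Qed.

Lemma sample_correlationE i j :
  sample_correlation X i j = D i j / (Num.sqrt (D i i) * Num.sqrt (D j j)).
Proof.
rewrite mxE centered_column_dot !euclidean_norm_centered.
(* For a constant column both sides are 0 by the convention on division, so affine invariance holds
   without exception. *)
have [->|d0] := eqVneq (Num.sqrt (D i i)) 0; first by rewrite mulr0 !mul0r invr0 !mulr0.
have [->|e0] := eqVneq (Num.sqrt (D j j)) 0; first by rewrite !mulr0 invr0 !mulr0.
by field; rewrite d0 e0 gt_eqF.
Qed.

Variables (z : 'I_n -> 'I_p -> R) (th eps B eta : R).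
Hypotheses (th_gt0 : 0 < th) (th_le : th <= eps / 100).
Hypotheses (eps_gt0 : 0 < eps) (eps_le2 : eps <= 2^-1).
Hypotheses (l_ge1 : 1 <= n%:R * th ^+ 2) (n_ge : 100 <= eps * n%:R).
Hypotheses (eta_ge0 : 0 <= eta) (eta_le1 : eta <= 1) (B_ge0 : 0 <= B).
Hypothesis eta_le : n%:R * (eta * (2 * B + 1)) <= 1.
Hypothesis z_le : forall k i, `|z k i| <= B.
Hypothesis yz : forall k i, `|y k i - z k i| <= eta.

Let l : R := n%:R * th ^+ 2.

Let eps_le1 : eps <= 1. Proof. by move: eps_le2; lra. Qed.

(** Each row contributes an error of at most eta^2 + 2 B eta, hence at most eta (2 B + 1); the mesh
    condition [eta_le] keeps the total below 1. *)
Let S_close i j : `|S i j - \sum_k z k i * z k j| <= 1.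
Proof.
apply: le_trans eta_le; rewrite /S -sumrB; apply: le_trans (ler_norm_sum _ _ _) _.
rewrite -[n in leRHS]card_ord mulr_natl -sumr_const; apply: ler_sum => k _.
have -> : y k i * y k j - z k i * z k j =
    (y k i - z k i) * (y k j - z k j) + z k j * (y k i - z k i)
    + z k i * (y k j - z k j) by ring.
apply: le_trans (ler_normD _ _) _; rewrite (le_trans (lerD (ler_normD _ _) (lexx _)))//.
rewrite !normrM.
have h1 : `|y k i - z k i| * `|y k j - z k j| <= eta * 1.
  by rewrite ler_pM// (le_trans (yz k j)).
have h2 : `|z k j| * `|y k i - z k i| <= B * eta by rewrite ler_pM.
have h3 : `|z k i| * `|y k j - z k j| <= B * eta by rewrite ler_pM.
by lra.
Qed.

Let U_close i : `|U i - \sum_k z k i| <= 1.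
Proof.
apply: le_trans eta_le; rewrite /U -sumrB; apply: le_trans (ler_norm_sum _ _ _) _.
rewrite -[n in leRHS]card_ord mulr_natl -sumr_const; apply: ler_sum => k _.
by apply: le_trans (yz k i) _; rewrite ler_peMr//; move: B_ge0; lra.
Qed.

Hypothesis z_total : forall i, `|th * \sum_k z k i| <= 3 * l.
Hypothesis z_norm : forall i,
  `|\sum_k z k i * z k i - n%:R| <= eps / 100 * n%:R.

Let th_le1 : th <= 1. Proof. by move: th_le eps_le1; lra. Qed.

Let U_le i : `|th * U i| <= 4 * l.
Proof.
have -> : th * U i = th * (\sum_k z k i) + th * (U i - \sum_k z k i) by ring.
apply: le_trans (ler_normD _ _) _.
have : `|th * (U i - \sum_k z k i)| <= 1.
  rewrite normrM gtr0_norm//; apply: le_trans (_ : th * 1 <= _); last by rewrite mulr1.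
  by rewrite ler_pM2l.
by have := z_total i; move: l_ge1; rewrite -/l; lra.
Qed.

(** As l = n th^2, the centring term is (th U_i) (th U_j) / l, hence of order l. That is negligible
    against n on the diagonal and, once multiplied by th, against l off it. *)
Let UU_le i j : `|U i * U j / n%:R| <= 16 * l.
Proof.
have -> : U i * U j / n%:R = (th * U i) * (th * U j) / l.
  by rewrite /l; field; rewrite !gt_eqF.
have l0 : 0 < l by apply: lt_le_trans l_ge1.
rewrite normrM normfV (gtr0_norm l0) ler_pdivrMr// normrM.
have -> : 16 * l * l = (4 * l) * (4 * l) by ring.
by rewrite ler_pM.
Qed.

Let l_small : 1700 * l <= eps * n%:R.
Proof.
have h : th ^+ 2 <= eps / 100 * (1 / 100).
  by rewrite expr2 ler_pM ?(ltW th_gt0)//; move: th_le eps_le1; lra.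
have := ler_wpM2l (ltW nR_gt0) h; rewrite -/l.
have := mulr_gt0 eps_gt0 nR_gt0.
by lra.
Qed.

Let D_diag i : (1 - eps / 25) * n%:R <= D i i <= (1 + eps / 25) * n%:R.
Proof.
have h1 := z_norm i; have h2 := S_close i i; have h3 := UU_le i i.
move: h1 h2 h3; rewrite !ler_norml /D => /andP[? ?] /andP[? ?] /andP[? ?].
by move: l_small n_ge => ? ?; apply/andP; split; lra.
Qed.

Let D_close i j : `|th * D i j - th * \sum_k z k i * z k j| <= eps / 5 * l.
Proof.
rewrite -mulrBr normrM gtr0_norm//.
have h : `|D i j - \sum_k z k i * z k j| <= 20 * l.
  have h2 := S_close i j; have h3 := UU_le i j.
  move: h2 h3; rewrite !ler_norml /D => /andP[? ?] /andP[? ?].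
  by move: l_ge1; rewrite -/l => ?; apply/andP; split; lra.
have -> : eps / 5 * l = eps / 100 * (20 * l) by field.
by rewrite ler_pM// ltW.
Qed.

Let sqrt_bounds i : Num.sqrt ((1 - eps / 25) * n%:R) <= Num.sqrt (D i i) <=
  Num.sqrt ((1 + eps / 25) * n%:R).
Proof.
have /andP[h1 h2] := D_diag i; apply/andP; split; apply: ler_wsqrtr => //.
Qed.

Let lo_gt0 : 0 < (1 - eps / 25) * n%:R.
Proof. by rewrite mulr_gt0//; move: eps_le1; lra. Qed.

Let hi_gt0 : 0 < (1 + eps / 25) * n%:R.
Proof. by rewrite mulr_gt0//; move: eps_gt0; lra. Qed.

Let den_ge i j : (1 - eps / 25) * n%:R <= Num.sqrt (D i i) * Num.sqrt (D j j).
Proof.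
rewrite -[leLHS]sqr_sqrtr ?(ltW lo_gt0)// expr2.
have /andP[? _] := sqrt_bounds i; have /andP[? _] := sqrt_bounds j.
by rewrite ler_pM// sqrtr_ge0.
Qed.

Let den_le i j : Num.sqrt (D i i) * Num.sqrt (D j j) <= (1 + eps / 25) * n%:R.
Proof.
rewrite -[leRHS]sqr_sqrtr ?(ltW hi_gt0)// expr2.
have /andP[_ ?] := sqrt_bounds i; have /andP[_ ?] := sqrt_bounds j.
by rewrite ler_pM// sqrtr_ge0.
Qed.

Let den_gt0 i j : 0 < Num.sqrt (D i i) * Num.sqrt (D j j).
Proof. exact: lt_le_trans (den_ge i j). Qed.

Hypothesis z_upper : forall i j : 'I_p, (i < j)%N ->
  `|th * \sum_k z k i * z k j| <= (2 + eps) * l.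
Hypothesis z_lower : exists i j : 'I_p, (i < j)%N /\
  (2 - eps) * l < th * \sum_k z k i * z k j.

Let l_gt0 : 0 < l. Proof. exact: lt_le_trans l_ge1. Qed.

Let eps2_le : eps ^+ 2 <= eps.
Proof. by rewrite expr2 ler_piMl// ltW. Qed.

Lemma coherence_close : `|Num.sqrt (n%:R / l) * coherence X - 2| <= 4 * eps.
Proof.
have -> : Num.sqrt (n%:R / l) = th^-1.
  have -> : n%:R / l = th^-1 ^+ 2 by rewrite /l; field; rewrite !gt_eqF.
  by rewrite sqrtr_sqr gtr0_norm// invr_gt0.
have th0 : 0 <= th^-1 by rewrite invr_ge0 ltW.
have up : th^-1 * coherence X <= 2 + 4 * eps.
  (* The maximum starts from 0, so the bound must be nonnegative as well. *)
  rewrite mulrC ler_pdivrMr//; apply: bigmax_le => [|[i j] /= ij].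
    by rewrite mulr_ge0 ?(ltW th_gt0)//; move: eps_gt0; lra.
  rewrite sample_correlationE normrM normfV (gtr0_norm (den_gt0 i j)).
  rewrite ler_pdivrMr//; apply: le_trans (ler_wpM2l _ (den_ge i j)); last first.
    by rewrite mulr_ge0 ?(ltW th_gt0)//; move: eps_gt0; lra.
  rewrite -(ler_pM2l th_gt0) -[X in X * `|_|](gtr0_norm th_gt0) -normrM.
  have h : `|th * D i j| <= (2 + 2 * eps) * l.
    have -> : th * D i j = th * (\sum_k z k i * z k j) +
       (th * D i j - th * \sum_k z k i * z k j) by ring.
    apply: le_trans (ler_normD _ _) _.
    have := z_upper ij; have := D_close i j; have := mulr_gt0 eps_gt0 l_gt0.
    by lra.
  apply: le_trans h _; rewrite /l.
  have -> : th * ((2 + 4 * eps) * th * ((1 - eps / 25) * n%:R)) =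
    ((2 + 4 * eps) * (1 - eps / 25)) * (n%:R * th ^+ 2) by ring.
  rewrite ler_pM2r//; have := eps2_le; rewrite expr2; move: eps_gt0; lra.
have lo : 2 - 4 * eps <= th^-1 * coherence X.
  rewrite [_^-1 * _]mulrC ler_pdivlMr//; have [i [j [ij zij]]] := z_lower.
  apply: le_trans (le_bigmax_cond 0 (fun ij : 'I_p * 'I_p =>
    `|sample_correlation X ij.1 ij.2|) (ij : (i, j).1 < (i, j).2)%N) => /=.
  apply: le_trans (ler_norm _).
  rewrite sample_correlationE ler_pdivlMr//.
  have d : (2 - 2 * eps) * l <= th * D i j.
    have := D_close i j; rewrite ler_norml => /andP[? _].
    have := mulr_gt0 eps_gt0 l_gt0; lra.
  (* This is where eps <= 1/2 is needed. *)
  have c0 : 0 <= (2 - 4 * eps) * th.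
    by rewrite mulr_ge0 ?(ltW th_gt0)//; move: eps_le2; lra.
  apply: le_trans (ler_wpM2l c0 (den_le i j)) _.
  rewrite -(ler_pM2l th_gt0); apply: le_trans d; rewrite /l.
  have -> : th * ((2 - 4 * eps) * th * ((1 + eps / 25) * n%:R)) =
    ((2 - 4 * eps) * (1 + eps / 25)) * (n%:R * th ^+ 2) by ring.
  rewrite ler_pM2r//; have := sqr_ge0 eps; rewrite expr2; move: eps_gt0; lra.
by rewrite ler_norml; apply/andP; split; lra.
Qed.

End affine_data.

Local Open Scope classical_set_scope.
Local Open Scope ring_scope.

(** * Measurability of the coherence *)

Section measurability.
Context {d : measure_display} {T : measurableType d} {R : realType}.

(** On nonnegative reals inversion is the power with exponent - 1, even at 0, where both are 0 by
    convention. *)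
Lemma measurable_invr_ge0 (f : T -> R) : (forall w, 0 <= f w) ->
  measurable_fun setT f -> measurable_fun setT (fun w => (f w)^-1).
Proof.
move=> f0 mf; have -> : (fun w => (f w)^-1) = (fun r => r `^ (- 1)) \o f.
  by apply/funext => w /=; rewrite powR_inv1.
exact: (measurableT_comp (measurable_powR _)).
Qed.

Lemma measurable_sqrt (f : T -> R) : (forall w, 0 <= f w) ->
  measurable_fun setT f -> measurable_fun setT (fun w => Num.sqrt (f w)).
Proof.
move=> f0 mf; have -> : (fun w => Num.sqrt (f w)) = (fun r => r `^ 2^-1) \o f.
  by apply/funext => w /=; rewrite powR12_sqrt.
exact: (measurableT_comp (measurable_powR _)).
Qed.

Lemma measurable_bigmax (I : Type) (s : seq I) (S : pred I) (f : I -> T -> R) :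
  (forall i, measurable_fun setT (f i)) ->
  measurable_fun setT (fun w => \big[Num.max/0]_(i <- s | S i) f i w).
Proof.
move=> mf; elim: s => [|i s IH].
  by under eq_fun do rewrite big_nil; exact: measurable_cst.
under eq_fun do rewrite big_cons; case: (S i) => //.
exact: measurable_maxr.
Qed.

Lemma measurable_coherence (n p : nat) (X : T -> 'M[R]_(n, p)) :
  (forall k i, measurable_fun setT (fun w => X w k i)) ->
  measurable_fun setT (fun w => coherence (X w)).
Proof.
move=> mX.
have mc i k : measurable_fun setT (fun w => centered_column (X w) i k 0).
  under eq_fun do rewrite !mxE /column_mean.
  apply: measurable_funB => //; apply: measurable_funM => //.
  exact: measurable_sum.
have mn i : measurable_fun setT (fun w => euclidean_norm (centered_column (X w) i)).
  apply: measurable_sqrt => [w|]; first by apply: sumr_ge0 => k _; exact: sqr_ge0.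
  by apply: measurable_sum => k; exact: measurable_funX.
have md (i j : 'I_p) : measurable_fun setT
    (fun w => ((centered_column (X w) i)^T *m centered_column (X w) j) 0 0).
  under eq_fun do rewrite mxE.
  apply: measurable_sum => k; under eq_fun do rewrite [X in X * _]mxE.
  exact: measurable_funM.
apply: measurable_bigmax => -[i j] /=; apply: measurableT_comp => //=.
under eq_fun do rewrite mxE.
apply: measurable_funM => //; apply: measurable_invr_ge0.
  by move=> w; rewrite mulr_ge0 ?sqrtr_ge0.
exact: measurable_funM.
Qed.

End measurability.

(** * Discretization of the entries *)

Lemma Pr_some_entry_le {R : realType} (A : finType) (w : A -> R) n p (a : A) :
  is_pmf w ->
  Pr (pow_pmf (pow_pmf w))
    (fun c : {ffun 'I_p -> {ffun 'I_n -> A}} => [exists i, [exists k, c i k == a]]) <=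
  p%:R * (n%:R * w a).
Proof.
move=> wP; have colP := pow_pmfP 'I_n wP; have powP := pow_pmfP 'I_p colP.
have col_le : Pr (pow_pmf w) (fun c : {ffun 'I_n -> A} => [exists k, c k == a]) <=
    n%:R * w a.
  apply: le_trans (Pr_exists_le colP xpredT (fun k c => c k == a)) _.
  rewrite (eq_bigr (fun=> w a)) => [|k _].
    by rewrite sumr_const card_ord mulr_natl.
  rewrite /Pr (Ex_marginal1 wP k (fun b => (b == a)%:R)) /Ex (bigD1 a)//= eqxx.
  by rewrite mulr1 big1 ?addr0// => b /negbTE ->; rewrite mulr0.
apply: le_trans (Pr_exists_le powP xpredT (fun i c => [exists k, c i k == a])) _.
rewrite (eq_bigr (fun=> Pr (pow_pmf w)
  (fun c : {ffun 'I_n -> A} => [exists k, c k == a]))) => [|i _].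
  by rewrite sumr_const card_ord -[_ *+ p]mulr_natl ler_wpM2l.
by rewrite /Pr (Ex_marginal1 colP i (fun c => [exists k, c k == a]%:R)).
Qed.

Section grid.
Context {R : realType}.
Variables (B eta : R).
Hypotheses (B_ge0 : 0 <= B) (eta_gt0 : 0 < eta).

Definition grid_size : nat := Num.truncn (2 * B / eta).

(* [None] marks the entries that exceed the truncation level. *)
Definition grid_level (u : R) : option 'I_grid_size.+1 :=
  if `|u| <= B then Some (inord (Num.truncn ((u + B) / eta))) else None.

(** A level is represented by the left end of its cell. Oversized entries are replaced by 0, so the
    bound B holds for every value. *)
Definition grid_value (v : option 'I_grid_size.+1) : R :=
  if v is Some k then k%:R * eta - B else 0.

Let level_bounds (u : R) : `|u| <= B ->
  [/\ 0 <= (u + B) / eta, (Num.truncn ((u + B) / eta) < grid_size.+1)%N &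
    (Num.truncn ((u + B) / eta))%:R * eta <= u + B <
    (Num.truncn ((u + B) / eta)).+1%:R * eta].
Proof.
rewrite ler_norml => /andP[u1 u2].
have t0 : 0 <= (u + B) / eta by rewrite divr_ge0 ?(ltW eta_gt0)//; lra.
split => //; last first.
  by rewrite -ler_pdivlMr// -ltr_pdivrMr// truncn_itv.
rewrite ltnS; apply: le_truncn; rewrite ler_wpM2r ?invr_ge0 ?(ltW eta_gt0)//.
by lra.
Qed.

Lemma normr_grid_value v : `|grid_value v| <= B.
Proof.
case: v => [k|] /=; last by rewrite normr0.
have : k%:R * eta <= 2 * B.
  have t0 : 0 <= 2 * B / eta by rewrite divr_ge0 ?(ltW eta_gt0)// mulr_ge0.
  have /andP[h _] := truncn_itv t0.
  by rewrite -ler_pdivlMr//; apply: le_trans h; rewrite ler_nat -ltnS ltn_ord.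
have : 0 <= k%:R * eta by rewrite mulr_ge0// ltW.
by rewrite ler_norml => ? ?; apply/andP; split; lra.
Qed.

Lemma grid_value_close u : `|u| <= B -> `|u - grid_value (grid_level u)| <= eta.
Proof.
move=> uB; have [_ kM /andP[k1 k2]] := level_bounds uB.
rewrite /grid_level uB /= inordK//; move: k2; rewrite -natr1 mulrDl mul1r => k2.
by rewrite ler_norml; apply/andP; split; lra.
Qed.

Lemma grid_level_None u : ~~ (`|u| <= B) -> grid_level u = None.
Proof. by rewrite /grid_level => /negbTE ->. Qed.

Lemma measurable_grid_level v : measurable (grid_level @^-1` [set v]).
Proof.
have mB : measurable `[- B, B]%classic by exact: measurable_itv.
case: v => [k|].
  have -> : grid_level @^-1` [set Some k] =
      `[- B, B]%classic `&` `[k%:R * eta - B, k.+1%:R * eta - B[%classic.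
    apply/seteqP; split=> [u|u [uB uk]] /=.
      rewrite /grid_level; case: ifPn => // uB [] ku.
      have [_ kM /andP[k1 k2]] := level_bounds uB.
      have ke : Num.truncn ((u + B) / eta) = k by rewrite -ku inordK.
      rewrite ke in k1 k2; rewrite !in_itv/= -ler_norml; split => //.
      by apply/andP; split; lra.
    move: uB uk; rewrite /= !in_itv/= -ler_norml => uB /andP[k1 k2].
    rewrite /grid_level uB; congr Some; apply: val_inj => /=.
    rewrite (truncn_def (n := k)) ?inordK//.
    by rewrite ler_pdivlMr// ltr_pdivrMr//; apply/andP; split; lra.
  by apply: measurableI; exact: measurable_itv.
have -> : grid_level @^-1` [set None] = ~` `[- B, B]%classic.
  apply/seteqP; split=> [u|u] /=; rewrite /grid_level in_itv/= -ler_norml.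
    by case: ifP => // ->.
  by move/negP/negbTE => ->.
exact: measurableC.
Qed.

End grid.

(** * Law of the discretized data matrix *)

Section discretized_iid.
Context {d : measure_display} {T : measurableType d} {R : realType}.
Variables (P : probability T R).

Lemma measure_bigsetU_le (I : Type) (s : seq I) (S : pred I) (A : I -> set T) :
  (forall i, measurable (A i)) ->
  (P (\big[setU/set0]_(i <- s | S i) A i) <= \sum_(i <- s | S i) P (A i))%E.
Proof.
move=> mA; elim: s => [|i s IH]; first by rewrite !big_nil measure0.
rewrite !big_cons; case: (S i) => //.
apply: le_trans (measureU2 _ _ _) _ => //; last by rewrite leeD2l.
by apply: bigsetU_measurable => j _.
Qed.

Lemma Rintegral_prob_cst (c : R) : \int[P]_w c = c.
Proof.
have /(congr1 fine) PT := @probability_setT _ _ _ P.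
by rewrite Rintegral_cst// [fine _]PT mulr1.
Qed.

(** Compares moments before and after discretization: c is the rounding error, tau G the error on
    the tail. *)
Lemma Rintegral_close (f h G : T -> R) (c tau : R) :
  P.-integrable setT (EFin \o f) -> P.-integrable setT (EFin \o h) ->
  P.-integrable setT (EFin \o G) ->
  (forall w, `|f w - h w| <= c + tau * G w) ->
  `|\int[P]_w f w - \int[P]_w h w| <= c + tau * \int[P]_w G w.
Proof.
move=> fi hi Gi fh.
have ci : P.-integrable setT (EFin \o cst c) by exact: finite_measure_integrable_cst.
have tGi : P.-integrable setT (EFin \o (fun w => tau * G w)).
  by have := integrableZl measurableT tau Gi.
rewrite -RintegralB//; apply: le_trans (le_normr_Rintegral _ _) _ => //.
  by have := integrableB measurableT fi hi.
have -> : c + tau * \int[P]_w G w = \int[P]_w (c + tau * G w).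
  by rewrite RintegralD// RintegralZl// Rintegral_prob_cst.
apply: le_Rintegral => //.
- by have := integrable_abse (integrableB measurableT fi hi).
- by have := integrableD measurableT ci tGi.
Qed.

Variable x : nat -> nat -> {RV P >-> R}.
Hypothesis x_iid : iid (fun ij : nat * nat => x ij.1 ij.2).
Variables (V : finType) (g : R -> V).
Hypothesis g_meas : forall v, measurable (g @^-1` [set v]).

Let cell (k i : nat) v : set T := x k i @^-1` (g @^-1` [set v]).

Let mcell k i v : measurable (cell k i v).
Proof. by rewrite -[X in measurable X]setTI; exact: measurable_funP. Qed.

Definition cell_pmf v : R := fine (P (cell 0 0 v)).

Let cell_pmfE k i v : P (cell k i v) = (cell_pmf v)%:E.
Proof.
rewrite /cell_pmf fineK ?fin_num_measure//.
exact: (x_iid.2 (k, i) (0%N, 0%N) _ (g_meas v)).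
Qed.

Let comp_sum (h : V -> R) w :
  h (g (x 0 0 w)) = \sum_v h v * \1_(cell 0 0 v) w.
Proof.
rewrite (bigD1 (g (x 0 0 w)))//= big1 ?addr0 => [|v vg].
  by rewrite indicE mem_set ?mulr1.
rewrite indicE memNset ?mulr0// /cell /= => e.
by move: vg; rewrite e eqxx.
Qed.

Let ind_integrable (h : V -> R) v :
  P.-integrable setT (fun w => (h v * \1_(cell 0 0 v) w)%:E).
Proof.
exact: (integrableZl measurableT (h v) (integrable_indic P (mcell 0 0 v))).
Qed.

Lemma integrable_discretized (h : V -> R) :
  P.-integrable setT (EFin \o (fun w => h (g (x 0 0 w)))).
Proof.
rewrite [X in _.-integrable _ X](_ : _ =
  (fun w => (\sum_(v <- index_enum V) (h v * \1_(cell 0 0 v) w)%:E)%E)).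
  exact: integrable_sum.
by apply/funext => w /=; rewrite comp_sum sumEFin.
Qed.

Lemma Ex_cell_pmf (h : V -> R) :
  Ex cell_pmf h = \int[P]_w h (g (x 0 0 w)).
Proof.
rewrite /Rintegral; under eq_integral => w _ do rewrite comp_sum -sumEFin.
rewrite integral_sum//.
have -> : (\sum_v \int[P]_w (h v * \1_(cell 0 0 v) w)%:E)%E =
    (\sum_v (cell_pmf v * h v)%:E)%E.
  apply: eq_bigr => v _; under eq_integral do rewrite EFinM.
  rewrite integralZl//; last exact: integrable_indic.
  by rewrite integral_indic// setIT [X in (_ * X)%E](cell_pmfE 0 0 v) -EFinM mulrC.
by rewrite sumEFin.
Qed.

Lemma cell_pmfP : is_pmf cell_pmf.
Proof.
split=> [v|]; first exact: fine_ge0.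
have := Ex_cell_pmf (fun=> 1); rewrite Rintegral_prob_cst => <-.
by apply: eq_bigr => v _; rewrite mulr1.
Qed.

Definition grid (n p : nat) (w : T) : {ffun 'I_p -> {ffun 'I_n -> V}} :=
  [ffun i : 'I_p => [ffun k : 'I_n => g (x k i w)]].

Let grid_pmf n p : {ffun 'I_p -> {ffun 'I_n -> V}} -> R :=
  pow_pmf (pow_pmf cell_pmf).

Let gridE n p v :
  [set w | grid n p w = v] = \bigcap_(ki in [set: 'I_n * 'I_p]) cell ki.1 ki.2 (v ki.2 ki.1).
Proof.
apply/seteqP; split=> [w <- [k i] _ /=|w wv]; first by rewrite /cell /= !ffunE.
by apply/ffunP => i; apply/ffunP => k; rewrite !ffunE; exact: (wv (k, i)).
Qed.

Let measurable_grid_eq n p v : measurable [set w | grid n p w = v].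
Proof.
rewrite gridE; apply: fin_bigcap_measurable => //; exact: finite_finset.
Qed.

Let P_grid_eq n p v : P [set w | grid n p w = v] = (grid_pmf v)%:E.
Proof.
pose h (ki : 'I_n * 'I_p) : nat * nat := (val ki.1, val ki.2).
have h_inj : injective h.
  by move=> [k i] [k' i'] [/val_inj -> /val_inj ->].
pose s := [seq h ki | ki <- enum {: 'I_n * 'I_p}].
pose J := [fset z in s]%fset.
(* Independence is stated for index pairs in nat. [insub] recovers the matrix position, and outside
   the matrix the constraint is void. *)
pose B (z : nat * nat) : set R :=
  if (insub z.1, insub z.2) is (Some k, Some i) then g @^-1` [set v i k] else setT.
have Bh ki : B (h ki) = g @^-1` [set v ki.2 ki.1].
  by rewrite /B /h/= !valK.
have mB z : measurable (B z).
  rewrite /B; case: insub => [k|]; last exact: measurableT.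
  by case: insub => [i|]; [exact: g_meas | exact: measurableT].
have hJ ki : h ki \in J by rewrite !inE; apply/map_f; rewrite mem_enum.
have := x_iid.1 J B mB.
have -> : \bigcap_(z in [set` J]) (x z.1 z.2 @^-1` B z) = [set w | grid n p w = v].
  rewrite gridE; apply/seteqP; split=> w wA.
    by move=> ki _; have := wA _ (hJ ki); rewrite /= Bh.
  move=> z /=; rewrite !inE => /mapP[ki _ ->].
  by have := wA ki I; rewrite /= Bh.
move=> ->; rewrite (perm_big s); last first.
  apply: uniq_perm; [exact: fset_uniq | | by move=> z; rewrite !inE].
  by rewrite map_inj_uniq// enum_uniq.
rewrite big_map big_enum /=.
have -> : (\prod_ki P (x (h ki).1 (h ki).2 @^-1` B (h ki)))%E =
    (\prod_ki (cell_pmf (v ki.2 ki.1))%:E)%E.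
  by apply: eq_bigr => ki _; rewrite Bh; exact: cell_pmfE.
rewrite prodEFin; congr _%:E; rewrite /grid_pmf /pow_pmf.
by rewrite exchange_big pair_bigA.
Qed.

Let grid_pred n p (Q : pred {ffun 'I_p -> {ffun 'I_n -> V}}) :
  [set w | Q (grid n p w)] = \big[setU/set0]_(v | Q v) [set w | grid n p w = v].
Proof.
apply/seteqP; split=> w /=.
  by move=> Qw; rewrite (bigD1 (grid n p w))//=; left.
by elim/big_rec : _ => [[]|v A Qv IH [/= wv|/IH//]]; rewrite /= wv.
Qed.

Lemma measurable_grid_pred n p (Q : pred {ffun 'I_p -> {ffun 'I_n -> V}}) :
  measurable [set w | Q (grid n p w)].
Proof. by rewrite grid_pred; apply: bigsetU_measurable. Qed.

(** Carries finite estimates back to P. An upper bound is all that is wanted, so subadditivity over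
    the grid values is enough. *)
Lemma P_grid_le n p (Q : pred {ffun 'I_p -> {ffun 'I_n -> V}}) :
  (P [set w | Q (grid n p w)] <= (Pr (grid_pmf (n := n) (p := p)) Q)%:E)%E.
Proof.
rewrite grid_pred; apply: le_trans (measure_bigsetU_le _ _ _) _ => //.
rewrite (eq_bigr _ (fun v _ => P_grid_eq v)) sumEFin lee_fin /Pr /Ex.
rewrite big_mkcond/=; apply: ler_sum => v _.
by case: (Q v); rewrite ?mulr1 ?mulr0.
Qed.

End discretized_iid.

(** * The probability bound at a fixed sample size *)

Section fixed_size.
Context {d : measure_display} {T : measurableType d} {R : realType}.
Variables (P : probability T R) (x : nat -> nat -> {RV P >-> R}).
Hypothesis x_iid : iid (fun ij : nat * nat => x ij.1 ij.2).
Variables (mu s : R) (G : T -> R) (n p : nat) (th ka eps B eta tau : R).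
Hypothesis s_gt0 : 0 < s.

Let std (r : R) : R := (r - mu) / s.
Let y w : R := std (x 0 0 w).
Let K : R := \int[P]_w G w.
Let l : R := n%:R * th ^+ 2.

Hypotheses (y_int : P.-integrable setT (EFin \o y)) (y_mean : \int[P]_w y w = 0).
Hypotheses (y2_int : P.-integrable setT (EFin \o (fun w => y w ^+ 2)))
  (y_var : \int[P]_w y w ^+ 2 = 1).
Hypotheses (G_int : P.-integrable setT (EFin \o G)) (G_ge0 : forall w, 0 <= G w).
Hypotheses (tau_ge0 : 0 <= tau)
  (tail_le : forall w, B < `|y w| -> 1 + `|y w| + y w ^+ 2 <= tau * G w).
Hypotheses (th_gt0 : 0 < th) (th_le : th <= ka) (B_ge1 : 1 <= B)
  (B_le : B ^+ 2 * th <= ka).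
Hypotheses (eps_gt0 : 0 < eps) (eps_le2 : eps <= 2^-1)
  (ka_le_eps : ka <= (eps / 1000) ^+ 2).
Hypotheses (l_eq : expR l = p%:R) (l_ge1 : 1 <= l)
  (l_large : 4 <= expR (l * (eps / 32) ^+ 2)) (n_ge : 100 <= eps * n%:R).
Hypotheses (eta_gt0 : 0 < eta) (eta_le1 : eta <= 1)
  (eta_le : n%:R * (eta * (2 * B + 1)) <= 1).
Hypotheses (mean_le : eta + tau * K <= ka * th)
  (var_le : eta * (2 * B + 1) + tau * K <= ka).

Let V := option 'I_(grid_size B eta).+1.
Let g (r : R) : V := grid_level B eta (std r).
Let q (v : V) : R := grid_value v.

Let B_ge0 : 0 <= B. Proof. by move: B_ge1; lra. Qed.

Let g_meas v : measurable (g @^-1` [set v]).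
Proof.
have mstd : measurable_fun setT std.
  by apply: measurable_funM => //; exact: measurable_funB.
rewrite -[X in measurable X]setTI.
apply: (mstd measurableT (grid_level B eta @^-1` [set v])).
exact: measurable_grid_level.
Qed.

Let pi : V -> R := cell_pmf x g.

Let pi_pmf : is_pmf pi. Proof. exact: cell_pmfP. Qed.

Let q_le v : `|q v| <= B. Proof. exact: normr_grid_value. Qed.

Let tauG_ge0 w : 0 <= tau * G w. Proof. by rewrite mulr_ge0. Qed.

Let q_close r : `|std r| <= B -> `|std r - q (g r)| <= eta.
Proof. exact: grid_value_close. Qed.

Let q_None r : B < `|std r| -> g r = None.
Proof. by rewrite ltNge => h; exact: grid_level_None. Qed.

(** Below B the error is the mesh eta; beyond B the value is 0 and the error |y| is part of
    [tail_le]. The summands y^2 and 1 of [tail_le] serve likewise for the variance and for the mass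
    of [None]. *)
Let mean_q : `|Ex pi q| <= ka * th.
Proof.
apply: le_trans mean_le; rewrite Ex_cell_pmf//.
have := Rintegral_close (integrable_discretized x g_meas q) y_int G_int
  (c := eta) (tau := tau) _.
rewrite y_mean subr0; apply => w.
have [yB|yB] := leP `|y w| B.
  by rewrite distrC (le_trans (q_close yB))// lerDl.
rewrite (q_None yB) sub0r normrN; apply: le_trans (_ : tau * G w <= _).
  by apply: le_trans (tail_le yB); have := sqr_ge0 (y w); lra.
by rewrite lerDr ltW.
Qed.

Let var_q : `|Ex pi (fun v => q v ^+ 2) - 1| <= ka.
Proof.
apply: le_trans var_le; rewrite Ex_cell_pmf//.
have := Rintegral_close (integrable_discretized x g_meas (fun v => q v ^+ 2)) y2_int G_int
  (c := eta * (2 * B + 1)) (tau := tau) _.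
rewrite y_var; apply => w.
have [yB|yB] := leP `|y w| B.
  apply: (@le_trans _ _ (eta * (2 * B + 1))); last by rewrite lerDl.
  rewrite subr_sqr normrM; apply: ler_pM => //.
    by rewrite distrC q_close.
  by apply: le_trans (ler_normD _ _) _; have := q_le (g (x 0 0 w)); lra.
rewrite (q_None yB) expr0n sub0r normrN ger0_norm ?sqr_ge0//.
apply: (@le_trans _ _ (tau * G w)).
  by apply: le_trans (tail_le yB); have := normr_ge0 (y w); lra.
by rewrite lerDr mulr_ge0 ?(ltW eta_gt0)//; move: B_ge0; lra.
Qed.

Let pi_None : pi None <= tau * K.
Proof.
have -> : pi None = Ex pi (fun v => (v == None)%:R).
  by rewrite /Ex (bigD1 None)//= mulr1 big1 ?addr0// => v /negbTE ->; rewrite mulr0.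
rewrite Ex_cell_pmf//.
have := Rintegral_close (integrable_discretized x g_meas (fun v => (v == None)%:R))
  (integrable_discretized x g_meas (fun=> 0)) G_int (c := 0) (tau := tau) _.
rewrite Rintegral_prob_cst subr0 add0r => h; apply: le_trans (ler_norm _) (h _).
move=> w; rewrite subr0 add0r.
have [yB|yB] := leP `|y w| B.
  by rewrite /g /grid_level yB normr0.
rewrite (q_None yB) normr1; apply: le_trans (tail_le yB).
by have := normr_ge0 (y w); have := sqr_ge0 (y w); lra.
Qed.

Let ka_small : ka <= 100^-1 /\ th <= eps / 100.
Proof.
have h : 1000 * (1000 * ka) <= eps ^+ 2 by move: ka_le_eps; rewrite exprMn; lra.
have h2 : eps ^+ 2 <= eps by rewrite expr2 ler_piMl ?(ltW eps_gt0)//; move: eps_le2; lra.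
by move: th_le th_gt0 eps_le2 => ? ? ?; split; lra.
Qed.

Let bad (v : {ffun 'I_p -> {ffun 'I_n -> V}}) : bool :=
  [exists i, [exists k, v i k == None]] || atypical q th eps v.

Let n_gt0 : (0 < n)%N.
Proof.
by rewrite lt0n; apply/eqP => n0; move: n_ge; rewrite n0 mulr0; lra.
Qed.

Let coherence_good w : ~~ bad (grid x g n p w) ->
  `|Num.sqrt (n%:R / l) * coherence (data_matrix x n p w) - 2| <= 4 * eps.
Proof.
rewrite negb_or => /andP[/existsPn noN].
rewrite /atypical !negb_or => /and4P[/existsPn h1 /existsPn h2 /existsPn h3].
move=> /forallPn[ij]; rewrite negb_imply -ltNge => /andP[ij_lt h4].
have [ka100 th100] := ka_small.
have gridE i k : grid x g n p w i k = g (x k i w) by rewrite !ffunE.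
have totE i : total q (grid x g n p w i) = \sum_(k < n) q (g (x k i w)).
  by apply: eq_bigr => k _; rewrite gridE.
have innE i j : inner q (grid x g n p w i) (grid x g n p w j) =
    \sum_(k < n) q (g (x k i w)) * q (g (x k j w)).
  by apply: eq_bigr => k _; rewrite !gridE.
have Xeq (k : 'I_n) (i : 'I_p) : data_matrix x n p w k i = s * std (x k i w) + mu.
  by rewrite mxE /std; field; rewrite gt_eqF.
apply: (@coherence_close _ _ _ _ (fun k i => std (x k i w)) mu s n_gt0 s_gt0 Xeq
  (fun k i => q (g (x k i w))) th eps B eta) => //.
- exact: ltW.
- move=> k i; have [yB|yB] := leP `|std (x k i w)| B; first exact: q_close.
  have /existsPn/(_ k) := noN i.
  by rewrite gridE (q_None yB) eqxx.
- by move=> i; have := h1 i; rewrite -leNgt totE.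
- by move=> i; have := h2 i; rewrite -leNgt innE.
- move=> i j ilj; have := h3 (i, j); rewrite negb_and /= ilj /= -leNgt innE.
  exact.
- by exists ij.1, ij.2; split => //; move: h4; rewrite innE.
Qed.

(** The event lies in a finite event on the grid: either one of the n p entries is oversized, or the
    grid is atypical. *)
Lemma P_coherence_far_le (e : R) : 4 * eps <= e ->
  (P [set w | (e < `|Num.sqrt (n%:R / l) * coherence (data_matrix x n p w) - 2|)%R]
   <= (p%:R * (n%:R * (tau * K)) + 48 * expR (- (l * (eps / 4))))%:E)%E.
Proof.
move=> eps_e; have [ka100 th100] := ka_small.
apply: (@le_trans _ _ (P [set w | bad (grid x g n p w)])).
  apply: le_measure; rewrite ?inE.
  - rewrite -[X in measurable X]setTI.
    have -> : [set w | e < `|Num.sqrt (n%:R / l) * coherence (data_matrix x n p w) - 2|] =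
      (fun w => `|Num.sqrt (n%:R / l) * coherence (data_matrix x n p w) - 2|) @^-1`
        `]e, +oo[%classic.
      by apply/seteqP; split => w /=; rewrite in_itv/= andbT.
    have mf : measurable_fun setT
       (fun w => `|Num.sqrt (n%:R / l) * coherence (data_matrix x n p w) - 2|).
      apply: measurableT_comp => //; apply: measurable_funB => //.
      apply: measurable_funM => //; apply: measurable_coherence => k i.
      by under eq_fun do rewrite mxE; exact: measurable_funP.
    by apply: mf => //; exact: measurable_itv.
  - exact: measurable_grid_pred.
  - move=> w /= far; apply/negPn/negP => /coherence_good.
    by rewrite leNgt (le_lt_trans eps_e far).
apply: le_trans (P_grid_le x_iid g_meas _) _; rewrite lee_fin.
have powP := pow_pmfP 'I_p (pow_pmfP 'I_n pi_pmf).
apply: le_trans (Pr_or_le powP _ _) _; apply: lerD.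
  apply: le_trans (Pr_some_entry_le n p None pi_pmf) _.
  by rewrite !ler_wpM2l.
apply: (Pr_atypical_le (ka := ka) (B := B)) => //.
by move: eps_le2; lra.
Qed.

End fixed_size.

(** * Asymptotics *)

Lemma quadratic_le_expR_powR {R : realType} (c a : R) : 0 < c -> 0 < a ->
  exists u0 : R, forall u, u0 <= u -> 1 + u + u ^+ 2 <= expR (c * u `^ a).
Proof.
(* The term of degree k + 1 of the exponential series has order at least u^3, which exceeds 3 u^2
   for large u. *)
move=> c0 a0; pose k := Num.truncn (3 / a).
have k3 : 3 <= a * k.+1%:R.
  have /truncn_itv/andP[_] : 0 <= 3 / a by rewrite divr_ge0// ltW.
  by rewrite ltr_pdivrMr// mulrC => /ltW.
pose C := c ^+ k.+1 / k.+1`!%:R.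
have C0 : 0 < C by rewrite divr_gt0 ?exprn_gt0// ltr0n fact_gt0.
exists (Num.max 1 (3 / C)) => u; rewrite ge_max => /andP[u1 uC].
have u0 : 0 <= u by lra.
have X0 : 0 <= c * u `^ a by rewrite mulr_ge0 ?powR_ge0 ?(ltW c0).
apply: le_trans (expR_ge1Dxn k X0).
rewrite exprMn -(powR_mulrn _ (powR_ge0 u a)) -powRrM.
have h3 : u ^+ 3 <= u `^ (a * k.+1%:R) by rewrite -powR_mulrn// ler_powR.
have h4 : 3 * u ^+ 2 <= C * u ^+ 3.
  rewrite [u ^+ 3]exprS [C * _]mulrA ler_wpM2r ?sqr_ge0//.
  by move: uC; rewrite ler_pdivrMr// [u * C]mulrC.
have h5 : C * u ^+ 3 <= C * u `^ (a * k.+1%:R) by rewrite ler_wpM2l// ltW.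
have h6 : C * u `^ (a * k.+1%:R) =
    c ^+ k.+1 * u `^ (a * k.+1%:R) / k.+1`!%:R by rewrite /C mulrAC.
rewrite -h6; have : u <= u ^+ 2 by rewrite expr2 ler_peMl.
by lra.
Qed.

(* At the truncation level [B = (ka / th)^(1/2)], where [th = (log p / n)^(1/2)],
   one has [B^al >= C n^be]; this is where the exponent [be = al / (4 + al)]
   comes from. *)
Lemma truncation_level_ge {R : realType} (al ka C l N : R) :
  0 < al -> 0 < ka -> 0 < C -> 0 < l -> 0 < N ->
  l <= ka ^+ 2 / C `^ (4 / al) * N `^ (al / (4 + al)) ->
  C * N `^ (al / (4 + al)) <= Num.sqrt (ka / Num.sqrt (l / N)) `^ al.
Proof.
move=> al0 ka0 C0 l0 N0 lle; set th := Num.sqrt (l / N).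
set B := Num.sqrt (ka / th).
have th0 : 0 < th by rewrite sqrtr_gt0 divr_gt0.
(* Two nested square roots make the fourth power explicit. The factor N / l has order at least N^(4
   / (4 + al)), the complementary exponent to al / (4 + al). *)
have B4 : B ^+ 4 = ka ^+ 2 * N / l.
  have -> : B ^+ 4 = (B ^+ 2) ^+ 2 by rewrite -exprM.
  rewrite sqr_sqrtr ?divr_ge0 ?ltW// expr_div_n sqr_sqrtr ?divr_ge0 ?ltW//.
  by field; rewrite !gt_eqF.
have -> : B `^ al = (B ^+ 4) `^ (al / 4).
  by rewrite -powR_mulrn ?sqrtr_ge0// -powRrM; congr (_ `^ _); field.
have CC : 0 < C `^ (4 / al) by exact: powR_gt0.
have NN : 0 < N `^ (al / (4 + al)) by exact: powR_gt0.
have h : C `^ (4 / al) * N `^ (4 / (4 + al)) <= B ^+ 4.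
  rewrite B4 ler_pdivlMr//.
  have -> : ka ^+ 2 * N = (C `^ (4 / al) * N `^ (4 / (4 + al))) *
      (ka ^+ 2 / C `^ (4 / al) * N `^ (al / (4 + al))).
    have NE : N `^ (4 / (4 + al)) * N `^ (al / (4 + al)) = N.
      rewrite -powRD; last by rewrite (gt_eqF N0) implybT.
      by rewrite -mulrDl divff ?powRr1 ?ltW// gt_eqF// addr_gt0.
    by rewrite -{1}NE; field; rewrite gt_eqF.
  by rewrite ler_wpM2l// mulr_ge0 ?powR_ge0.
have -> : C * N `^ (al / (4 + al)) = (C `^ (4 / al) * N `^ (4 / (4 + al))) `^ (al / 4).
  rewrite powRM ?powR_ge0// -!powRrM.
  have -> : 4 / al * (al / 4) = 1 by field; rewrite gt_eqF.
  have -> : 4 / (4 + al) * (al / 4) = al / (4 + al).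
    by field; rewrite gt_eqF// addr_gt0.
  by rewrite powRr1 ?ltW.
apply: ge0_ler_powR => //; first by rewrite divr_ge0 ?ltW.
  by rewrite nnegrE mulr_ge0 ?powR_ge0.
by rewrite nnegrE exprn_ge0 ?sqrtr_ge0.

Qed.

Lemma cvg0_of_near_le {R : realType} (u : nat -> \bar R) :
  (forall n, 0 <= u n)%E ->
  (forall e : R, 0 < e -> \forall n \near \oo, (u n <= e%:E)%E) ->
  u n @[n --> \oo] --> 0%E.
Proof.
move=> u0 ule; apply/fine_cvgP; split.
  near=> n; rewrite ge0_fin_numE//; apply: (@le_lt_trans _ _ 1%:E); last exact: ltry.
  by near: n; exact: ule.
apply/cvgrPdist_le => e e0; near=> n.
have un : (u n <= e%:E)%E by near: n; exact: ule.
have uf : u n \is a fin_num by rewrite ge0_fin_numE// (le_lt_trans un) ?ltry.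
rewrite sub0r normrN ger0_norm /=; last exact: fine_ge0.
by rewrite -lee_fin fineK.
Unshelve. all: by end_near.
Qed.

(** * Moments of the standardized entries *)

Section standardized_moments.
Context {d : measure_display} {T : measurableType d} {R : realType}.
Variables (P : probability T R) (X : {RV P >-> R}) (mu s al t0 : R).
Hypotheses (s_gt0 : 0 < s) (al_gt0 : 0 < al) (t0_gt0 : 0 < t0).
Hypotheses (X_mean : ('E_P[X] = mu%:E)%E) (X_var : ('V_P[X] = (s ^+ 2)%:E)%E).

Let G w : R := expR (t0 * `|X w| `^ al).
Let y w : R := (X w - mu) / s.

Hypothesis G_fin : ('E_P[G] < +oo)%E.

Let mX : measurable_fun setT (X : T -> R). Proof. exact: measurable_funP. Qed.

Let my : measurable_fun setT y.
Proof. by apply: measurable_funM => //; exact: measurable_funB. Qed.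

Lemma integrable_exp_moment : P.-integrable setT (EFin \o G).
Proof.
apply/integrableP; split.
  apply/measurable_EFinP; apply: measurableT_comp => //.
  apply: measurable_funM => //.
  apply: (measurableT_comp (measurable_powR _)) => //.
  exact: measurableT_comp.
move: G_fin; rewrite unlock; apply: le_lt_trans.
rewrite le_eqVlt; apply/orP; left; apply/eqP; apply: eq_integral => w _ /=.
by rewrite ger0_norm ?expR_ge0.
Qed.

Lemma exp_moment_tail : exists c b : R, [/\ 0 < c, 1 <= b &
  forall w, b <= `|y w| ->
    (1 + `|y w| + y w ^+ 2) * expR (c * `|y w| `^ al) <= G w].
Proof.
(* If |y| >= 2 |mu| / s, then |X| >= (s / 2) |y|, so the exponent of G is at least 2 c |y|^al. One
   half absorbs the quadratic polynomial, the other remains as decay. *)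
pose c := t0 * (s / 2) `^ al / 2.
have c0 : 0 < c by rewrite divr_gt0// mulr_gt0// powR_gt0// divr_gt0.
have [u0 hu0] := quadratic_le_expR_powR c0 al_gt0.
exists c, (Num.max 1 (Num.max u0 (2 * `|mu| / s))); split => //.
  by rewrite le_max lexx.
move=> w; rewrite !ge_max => /and3P[y1 yu ymu].
have h := hu0 _ yu; rewrite (real_normK (num_real (y w))) in h.
apply: le_trans (ler_wpM2r (expR_ge0 _) h) _; rewrite -expRD ler_expR.
have -> : c * `|y w| `^ al + c * `|y w| `^ al = t0 * (s / 2 * `|y w|) `^ al.
  by rewrite powRM ?divr_ge0 ?(ltW s_gt0)// /c; field.
rewrite ler_wpM2l ?(ltW t0_gt0)//.
apply: ge0_ler_powR; rewrite ?nnegrE ?mulr_ge0 ?divr_ge0 ?(ltW s_gt0) ?(ltW al_gt0)//.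
have Xw : X w = s * y w + mu by rewrite /y; field; rewrite gt_eqF.
have : s * `|y w| <= `|X w| + `|mu|.
  rewrite -{1}(gtr0_norm s_gt0) -normrM.
  have -> : s * y w = X w - mu by rewrite Xw addrK.
  exact: ler_normB.
by move: ymu; rewrite ler_pdivrMr//; lra.
Qed.

Let y_dominated : exists C : R, forall w, `|y w| <= C + G w /\ `|y w ^+ 2| <= C + G w.
Proof.
have [c [b [c0 b1 h]]] := exp_moment_tail.
exists (1 + b + b ^+ 2) => w.
have G0 : 0 <= G w by exact: expR_ge0.
have y0 := normr_ge0 (y w); rewrite normrX.
have [yb|yb] := leP b `|y w|.
  have yG : 1 + `|y w| + `|y w| ^+ 2 <= G w.
    apply: le_trans (h w yb); rewrite (real_normK (num_real (y w))).
    apply: ler_peMr; first by have := sqr_ge0 (y w); lra.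
    by rewrite -expR0 ler_expR mulr_ge0 ?powR_ge0 ?(ltW c0).
  by have := sqr_ge0 `|y w|; have := sqr_ge0 b; split; lra.
have yb2 : `|y w| ^+ 2 <= b ^+ 2 by rewrite ler_sqr ?nnegrE; lra.
by have := sqr_ge0 b; split; lra.
Qed.

Let dominated_integrable (f : T -> R) : measurable_fun setT f ->
  (exists C, forall w, `|f w| <= C + G w) -> P.-integrable setT (EFin \o f).
Proof.
move=> mf [C fC].
have CGi : P.-integrable setT (EFin \o (fun w => C + G w)).
  have Ci : P.-integrable setT (EFin \o cst C) by exact: finite_measure_integrable_cst.
  by have := integrableD measurableT Ci integrable_exp_moment.
apply: le_integrable CGi => //; first exact/measurable_EFinP.
by move=> w _ /=; rewrite lee_fin (le_trans (fC w))// ler_norm.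
Qed.

Lemma integrable_standardized : P.-integrable setT (EFin \o y).
Proof.
have [C hC] := y_dominated; apply: dominated_integrable => //.
by exists C => w; have [] := hC w.
Qed.

Lemma integrable_standardized_sqr : P.-integrable setT (EFin \o (fun w => y w ^+ 2)).
Proof.
have [C hC] := y_dominated; apply: dominated_integrable.
  exact: measurable_funX.
by exists C => w; have [] := hC w.
Qed.

Let Xw w : X w = s * y w + mu. Proof. by rewrite /y; field; rewrite gt_eqF. Qed.

Lemma standardized_mean : \int[P]_w y w = 0.
Proof.
have Xm : \int[P]_w X w = mu by rewrite /Rintegral -expectation_def X_mean.
have : \int[P]_w (s * y w + mu) = s * (\int[P]_w y w) + mu.
  rewrite RintegralD ?RintegralZl ?Rintegral_prob_cst//.
  - exact: integrable_standardized.
  - by have := integrableZl measurableT s integrable_standardized.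
  - exact: finite_measure_integrable_cst.
have -> : \int[P]_w (s * y w + mu) = mu.
  by rewrite -[RHS]Xm; apply: eq_Rintegral => w _; rewrite Xw.
rewrite -[LHS]add0r => /addIr/esym/eqP.
by rewrite mulf_eq0 (gt_eqF s_gt0) => /eqP.
Qed.

Lemma standardized_second_moment : \int[P]_w y w ^+ 2 = 1.
Proof.
have h : \int[P]_w (s ^+ 2 * y w ^+ 2) = s ^+ 2.
  move: X_var; rewrite /variance unlock X_mean unlock /= => /(congr1 fine) /= e.
  rewrite -[RHS]e; apply: eq_Rintegral => w _.
  change (s ^+ 2 * y w ^+ 2 = (X w - mu) * (X w - mu)).
  by rewrite Xw; ring.
move: h; rewrite RintegralZl//; last exact: integrable_standardized_sqr.
by rewrite -[RHS]mulr1 => /mulfI; apply; rewrite expf_neq0// gt_eqF.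
Qed.

End standardized_moments.

Lemma mesh_exists {R : realType} (ka th B N r : R) :
  0 < ka -> ka <= 1 -> 0 < th -> th <= 1 -> 1 <= B -> 1 <= N ->
  r <= ka * th / 2 ->
  exists eta, [/\ 0 < eta, eta <= 1, N * (eta * (2 * B + 1)) <= 1,
    eta + r <= ka * th & eta * (2 * B + 1) + r <= ka].
Proof.
move=> ka0 ka1 th0 th1 B1 N1 rle.
have N0 : 0 < N by lra.
have B21 : 1 <= 2 * B + 1 by lra.
have B0 : 0 < 2 * B + 1 by lra.
have kath : 0 < ka * th by rewrite mulr_gt0.
have kath_ka : ka * th <= ka by rewrite ler_piMr// ltW.
(* Half of the budget ka th goes to the mesh, the other half to the tail term r. *)
pose eta := ka * th / 2 / (N * (2 * B + 1)).
have eta0 : 0 < eta by rewrite divr_gt0 ?mulr_gt0// divr_gt0.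
have etaE : N * (eta * (2 * B + 1)) = ka * th / 2.
  by rewrite /eta; field; rewrite !gt_eqF.
have h1 : eta * (2 * B + 1) <= ka * th / 2.
  by rewrite -etaE ler_peMl// mulr_ge0 ?ltW.
have h2 : eta <= eta * (2 * B + 1) by rewrite ler_peMr// ltW.
by exists eta; split => //; rewrite ?etaE; lra.
Qed.

(** Since l >= 1, th is at least 1 / N. The factor N^2 in the denominator therefore leaves a spare 1
    / N, which absorbs 2 K / ka. *)
Lemma tail_mass_le {R : realType} (ka th l N q K : R) :
  0 < ka -> 1 <= N -> 1 <= l -> 1 <= q -> 0 <= K -> 2 * K / ka <= N ->
  0 < th -> th ^+ 2 = l / N -> (N ^+ 2 * q)^-1 * K <= ka * th / 2.
Proof.
move=> ka0 N1 l1 q1 K0 KN th0 th2.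
have N0 : 0 < N by lra.
have q0 : 0 < q by lra.
have th_N : N^-1 <= th.
  rewrite -ler_sqr ?nnegrE ?invr_ge0 ?(ltW th0) ?(ltW N0)// th2 expr2.
  rewrite ler_wpM2r ?invr_ge0 ?(ltW N0)//.
  by apply: le_trans l1; rewrite invf_le1.
apply: (@le_trans _ _ (ka / 2 * N^-1)); last first.
  by rewrite [leRHS]mulrAC ler_wpM2l// divr_ge0 ?ltW.
rewrite mulrC ler_pdivrMr ?mulr_gt0 ?exprn_gt0//.
have -> : ka / 2 / N * (N ^+ 2 * q) = (ka * N / 2) * q.
  by field; rewrite gt_eqF.
have h : K <= ka * N / 2 by move: KN; rewrite ler_pdivrMr//; lra.
by apply: le_trans h _; rewrite ler_peMr// divr_ge0// mulr_ge0 ?ltW.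
Qed.

Lemma probability_bound_le {R : realType} (K N l eps tgt : R) :
  0 < eps -> 0 < tgt -> 0 < N -> 2 * K / tgt <= N ->
  4 / eps * (96 / tgt) <= l -> K / N + 48 * expR (- (l * (eps / 4))) <= tgt.
Proof.
move=> eps0 tgt0 N0 KN l_tgt.
have h1 : K / N <= tgt / 2.
  by rewrite ler_pdivrMr//; move: KN; rewrite ler_pdivrMr//; lra.
have z_ge : 96 / tgt <= l * (eps / 4).
  have -> : 96 / tgt = 4 / eps * (96 / tgt) * (eps / 4).
    by field; rewrite !gt_eqF.
  by rewrite ler_wpM2r// divr_ge0// ltW.
(* From exp z >= 1 + z >= z; multiplied by 48 this leaves half of the target. *)
have h2 : expR (- (l * (eps / 4))) <= tgt / 96.
  rewrite expRN -[leRHS]invrK lef_pV2 ?posrE ?invr_gt0 ?divr_gt0 ?expR_gt0//.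
  rewrite invf_div; apply: le_trans z_ge (le_trans _ (expR_ge1Dx _)).
  by rewrite lerDr.
by move: h1 h2; lra.
Qed.

Theorem theorem2 (d : measure_display) (T : measurableType d) (R : realType)
    (P : probability T R) (x : nat -> nat -> {RV P >-> R})
    (mu sigma alpha t0 : R) (p : nat -> nat)
    (x_iid : iid (fun ij : nat * nat => x ij.1 ij.2))
    (x_mean : forall i j, ('E_P[x i j] = mu%:E)%E)
    (x_var : forall i j, ('V_P[x i j] = (sigma ^+ 2)%:E)%E)
    (sigma_gt0 : 0 < sigma ^+ 2)
    (alpha_gt0 : 0 < alpha) (t0_gt0 : 0 < t0)
    (x_exp_moment :
      ('E_P[fun w => expR (t0 * `|x 0%N 0%N w| `^ alpha)] < +oo)%E)
    (p_gt0 : forall n, (0 < n)%N -> (0 < p n)%N)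
    (p_oo : p n @[n --> \oo] --> \oo)
    (log_p : (fun n => ln (p n)%:R : R) =o_\oo
             (fun n => n%:R `^ (alpha / (4 + alpha)) : R)) :
  cvg_in_probability P
    (fun n w => Num.sqrt (n%:R / ln (p n)%:R) *
                coherence (data_matrix x n (p n) w))
    (fun=> 2).
Proof.
(* Only the square of sigma is known to be positive; sigma itself may be negative. *)
pose s := `|sigma|.
have s_gt0 : 0 < s.
  rewrite normr_gt0; move: sigma_gt0; apply: contraTneq => ->.
  by rewrite expr0n ltxx.
have x_var' : ('V_P[x 0%N 0%N] = (s ^+ 2)%:E)%E by rewrite x_var real_normK ?num_real.
pose G w := expR (t0 * `|x 0%N 0%N w| `^ alpha).
pose K := \int[P]_w G w.
have G_int := integrable_exp_moment x_exp_moment.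
have K_ge0 : 0 <= K by apply: Rintegral_ge0 => w _; exact: expR_ge0.
have [c [b [c_gt0 b_ge1 tail]]] :=
  exp_moment_tail (x 0%N 0%N) mu s_gt0 alpha_gt0 t0_gt0.
have y_int := integrable_standardized mu s_gt0 alpha_gt0 t0_gt0 x_exp_moment.
have y2_int := integrable_standardized_sqr mu s_gt0 alpha_gt0 t0_gt0 x_exp_moment.
have y_mean := standardized_mean s_gt0 alpha_gt0 t0_gt0 (x_mean 0%N 0%N) x_exp_moment.
have y_var := standardized_second_moment s_gt0 alpha_gt0 t0_gt0 (x_mean 0%N 0%N)
  x_var' x_exp_moment.
move=> e e_gt0.
have [eps [eps_gt0 eps_le2 eps_e]] : exists eps : R, [/\ 0 < eps, eps <= 2^-1 & 4 * eps <= e].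
  exists (Num.min e 1 / 4).
  have min1 : Num.min e 1 <= 1 by rewrite ge_min lexx orbT.
  have mine : Num.min e 1 <= e by rewrite ge_min lexx.
  by split; [rewrite divr_gt0// lt_min e_gt0 ltr01 | lra | lra].
have [ka [ka_gt0 ka_le1 ka_eps]] : exists ka : R,
    [/\ 0 < ka, ka <= 1 & ka <= (eps / 1000) ^+ 2].
  have k_gt0 : 0 < eps / 1000 by lra.
  exists ((eps / 1000) ^+ 2); split; [exact: exprn_gt0 | | exact: lexx].
  by apply: exprn_ile1; lra.
pose be := alpha / (4 + alpha).
have be_gt0 : 0 < be by rewrite divr_gt0// addr_gt0.
have be_le1 : be <= 1 by rewrite ler_pdivrMr ?addr_gt0// mul1r; lra.
have C_gt0 : 0 < 2 / c by rewrite divr_gt0.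
(* The bound th <= nu gives th <= ka and, as B^2 = ka / th, also b <= B, so the tail estimate holds
   beyond B. *)
pose nu := Num.min ka (ka / b ^+ 2).
have b_gt0 : 0 < b by exact: lt_le_trans b_ge1.
have nu_gt0 : 0 < nu by rewrite lt_min ka_gt0 divr_gt0// exprn_gt0.
have [u0 hu0] := quadratic_le_expR_powR (ltr01 : 0 < 1 :> R) be_gt0.
have log_le (dl : R) : 0 < dl -> \forall n \near \oo, ln (p n)%:R <= dl * n%:R `^ be.
  move=> dl0; move/eqoP: log_p => /(_ dl dl0); apply: filterS => n h.
  by apply: le_trans (ler_norm _) _; rewrite -[n%:R `^ be]ger0_norm ?powR_ge0.
have log_ge (L : R) : \forall n \near \oo, L <= ln (p n)%:R.
  have pL : \forall n \near \oo, expR L <= (p n)%:R.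
    exact: (p_oo _ (nbhs_infty_ger (expR L))).
  apply: filterS pL => n h.
  have pn0 : (0 : R) < (p n)%:R by exact: lt_le_trans (expR_gt0 L) h.
  by rewrite -ler_expR lnK.
apply: cvg0_of_near_le => [n|tgt tgt_gt0]; first exact: measure_ge0.
near=> n.
have l_ge1 : 1 <= ln (p n)%:R :> R by near: n; exact: log_ge.
have l_ge4 : 4 / (eps / 32) ^+ 2 <= ln (p n)%:R by near: n; exact: log_ge.
have l_tgt : 4 / eps * (96 / tgt) <= ln (p n)%:R by near: n; exact: log_ge.
have l_le1 : ln (p n)%:R <= 1 * n%:R `^ be by near: n; exact: log_le.
have l_nu : ln (p n)%:R <= nu ^+ 2 * n%:R `^ be.
  by near: n; apply: log_le; rewrite exprn_gt0.
have l_trunc : ln (p n)%:R <= ka ^+ 2 / (2 / c) `^ (4 / alpha) * n%:R `^ be.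
  near: n; apply: log_le; apply: divr_gt0; [exact: exprn_gt0 | exact: powR_gt0].
set l : R := ln (p n)%:R in l_ge1 l_ge4 l_tgt l_le1 l_nu l_trunc *.
have n_ge1 : (1 : R) <= n%:R by near: n; exact: nbhs_infty_ger.
have n_eps : 100 / eps <= n%:R by near: n; exact: nbhs_infty_ger.
have n_ka : 2 * K / ka <= n%:R by near: n; exact: nbhs_infty_ger.
have n_tgt : 2 * K / tgt <= n%:R by near: n; exact: nbhs_infty_ger.
have n_u0 : u0 <= n%:R by near: n; exact: nbhs_infty_ger.
have n_gt0 : (0 : R) < n%:R by exact: lt_le_trans n_ge1.
have l_gt0 : 0 < l by exact: lt_le_trans l_ge1.
have pn_gt0 : (0 : R) < (p n)%:R.
  by rewrite ltr0n p_gt0// -(ltr0n R).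
have l_eq : expR l = (p n)%:R by rewrite lnK.
have pn_ge1 : (1 : R) <= (p n)%:R by rewrite -l_eq -expR0 ler_expR ltW.
pose th := Num.sqrt (l / n%:R).
have th_gt0 : 0 < th by rewrite sqrtr_gt0 divr_gt0.
have th2 : th ^+ 2 = l / n%:R by rewrite sqr_sqrtr// divr_ge0// ltW.
have lE : n%:R * th ^+ 2 = l by rewrite th2; field; rewrite gt_eqF.
(* Here be <= 1 enters: th^2 = l / n is at most nu^2 n^(be - 1). *)
have th_nu : th <= nu.
  rewrite -ler_sqr ?nnegrE ?(ltW th_gt0) ?(ltW nu_gt0)// th2 ler_pdivrMr//.
  apply: le_trans l_nu _; rewrite ler_wpM2l ?sqr_ge0//.
  by rewrite -[leRHS]powRr1 ?ler_powR// ltW.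
have th_ka : th <= ka by apply: le_trans th_nu _; rewrite ge_min lexx.
have th_b : th <= ka / b ^+ 2 by apply: le_trans th_nu _; rewrite ge_min lexx orbT.
pose B := Num.sqrt (ka / th).
have B2 : B ^+ 2 = ka / th by rewrite sqr_sqrtr// divr_ge0// ltW.
have b_le_B : b <= B.
  rewrite -ler_sqr ?nnegrE ?sqrtr_ge0 ?(ltW b_gt0)// B2 ler_pdivlMr//.
  by move: th_b; rewrite ler_pdivlMr ?exprn_gt0// mulrC.
have B_ge1 : 1 <= B by exact: le_trans b_le_B.
have B_le : B ^+ 2 * th <= ka by rewrite B2 divfK// gt_eqF.
(* With this weight the union bound over the n p entries is K / n, which tends to 0. *)
pose tau : R := (n%:R ^+ 2 * (p n)%:R)^-1.
have n2p_gt0 : 0 < n%:R ^+ 2 * (p n)%:R :> R by rewrite mulr_gt0// exprn_gt0.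
have tau_ge0 : 0 <= tau by rewrite invr_ge0 ltW.
(* Both n^2 and p are at most exp (n^be), and the truncation level was tuned with the constant 2 / c
   to give c B^alpha >= 2 n^be. *)
have n2p_le : n%:R ^+ 2 * (p n)%:R <= expR (c * B `^ alpha).
  apply: (@le_trans _ _ (expR (n%:R `^ be) * expR (n%:R `^ be))).
    apply: ler_pM; [exact: sqr_ge0 | exact: ltW | |].
      have := hu0 _ n_u0; rewrite mul1r; apply: le_trans.
      by rewrite lerDr addr_ge0// ltW.
    by rewrite -l_eq ler_expR; move: l_le1; rewrite mul1r.
  rewrite -expRD ler_expR.
  have := truncation_level_ge alpha_gt0 ka_gt0 C_gt0 l_gt0 n_gt0 l_trunc.
  move/(ler_wpM2l (ltW c_gt0)); apply: le_trans.
  rewrite le_eqVlt; apply/orP; left; apply/eqP.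
  by rewrite -/be; field; rewrite gt_eqF.
have tail_tau w : B < `|(x 0%N 0%N w - mu) / s| ->
    1 + `|(x 0%N 0%N w - mu) / s| + ((x 0%N 0%N w - mu) / s) ^+ 2 <= tau * G w.
  move: (tail w); rewrite -/(G w); move: (_ / s) (G w) => Y g tailY By.
  rewrite [tau * _]mulrC ler_pdivlMr//.
  apply: le_trans (tailY (le_trans b_le_B (ltW By))).
  apply: ler_wpM2l; first by rewrite addr_ge0 ?sqr_ge0// addr_ge0.
  apply: le_trans n2p_le _; rewrite ler_expR; apply: ler_wpM2l; first exact: ltW.
  by apply: ge0_ler_powR; rewrite ?nnegrE ?(ltW alpha_gt0) ?sqrtr_ge0 ?normr_ge0 ?(ltW By).
have th_le1 : th <= 1 by exact: le_trans th_ka ka_le1.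
have tauK := tail_mass_le ka_gt0 n_ge1 l_ge1 pn_ge1 K_ge0 n_ka th_gt0 th2.
have [eta [eta_gt0 eta_le1 eta_n mean_le var_le]] :=
  mesh_exists ka_gt0 ka_le1 th_gt0 th_le1 B_ge1 n_ge1 tauK.
have l_large : 4 <= expR (l * (eps / 32) ^+ 2).
  apply: le_trans (expR_ge1Dx _).
  move: l_ge4; rewrite ler_pdivrMr ?exprn_gt0 ?divr_gt0//; lra.
have n_ge : 100 <= eps * n%:R by move: n_eps; rewrite ler_pdivrMr// mulrC.
have := @P_coherence_far_le d T R P x x_iid mu s G n (p n) th ka eps B eta tau
  s_gt0 y_int y_mean y2_int y_var G_int (fun w => expR_ge0 _) tau_ge0 tail_tau
  th_gt0 th_ka B_ge1 B_le eps_gt0 eps_le2 ka_eps.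
rewrite lE => /(_ l_eq l_ge1 l_large n_ge eta_gt0 eta_le1 eta_n mean_le var_le e eps_e).
move=> h; apply: le_trans h _; rewrite lee_fin -/K.
have -> : (p n)%:R * (n%:R * (tau * K)) = K / n%:R.
  by rewrite /tau; field; rewrite !gt_eqF.
exact: probability_bound_le.
Unshelve. all: by end_near.
Qed.
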